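(* For every pair $\binom{\alpha}{\beta}$ with $\alpha=(\alpha_1,\dots,\alpha_k)\in\mathbb N^k$ and $\beta=(\beta_1,\dots,\beta_k)\in\mathbb P^k$ ($k\ge 0$), the regularization $\phi\binom{\alpha}{\beta}$ is a well-defined element of $\mathrm{GSym}[t][z^{-1},z]]$. The linear map $$\phi:H\to \mathrm{GSym}[t][z^{-1},z]],\qquad \tbinom{\alpha}{\beta}\mapsto \phi\tbinom{\alpha}{\beta},$$ is an algebra homomorphism, where $H$ carries the quasi-shuffle product. Moreover, if $k\ge1$ and $\alpha_k>0$, then $\phi\binom{\alpha}{\beta}\in \mathrm{GSym}[t][[z]]$.
   Context: $\mathbb P$ denotes the positive and $\mathbb N$ the nonnegative integers. Let $X=\{x_i: i\in\mathbb P\}$ be commuting indeterminates. For $\alpha\in\mathbb N^k$ with $k=0$ or $\alpha_k>0$, and $\beta\in\mathbb N^k$, the Stirling left weak quasisymmetric function is $$\widehat M_{\binom{\alpha}{\beta}}=\sum_{0<i_1<\cdots<i_k} i_1^{\beta_1}\cdots i_k^{\beta_k}\,x_{i_1}^{\alpha_1}\cdots x_{i_k}^{\alpha_k}\in\mathbb Q[[X]].$$ $\mathrm{GSym}$ is the $\mathbb Q$-span of all such $\widehat M_{\binom{\alpha}{\beta}}$; it is a subalgebra of $\mathbb Q[[X]]$. Quasi-shuffle algebra. For an additive semigroup $A$, $\mathrm{QS}(A)$ is the free module with basis all finite sequences of elements of $A$, including the empty sequence $\emptyset$, which is the unit. The product $*$ is defined recursively by $$a*b=(a_1,(a_2,\dots,a_m)*b)+(b_1,a*(b_2,\dots,b_n))+(a_1+b_1,(a_2,\dots,a_m)*(b_2,\dots,b_n))$$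 for $a=(a_1,\dots,a_m)$ and $b=(b_1,\dots,b_n)$. Here $(c,\sum\lambda_u u)$ means $\sum\lambda_u(c,u)$. $H=\mathrm{QS}(\mathbb N\times\mathbb P)$ is taken over $\mathbb Q$. Its basis consists of the matrices $\binom{\alpha}{\beta}=\binom{\alpha_1,\dots,\alpha_k}{\beta_1,\dots,\beta_k}$ with $\alpha\in\mathbb N^k$ and $\beta\in\mathbb P^k$. Columns are added componentwise. Regularization. For such $\binom{\alpha}{\beta}$, real $t\ge0$ and complex $z$ with $\mathrm{Re}(z)<0$, consider $$\phi\tbinom{\alpha}{\beta}(t,z)=\sum_{0<i_1<\cdots<i_k}x_{i_1}^{\alpha_1}\cdots x_{i_k}^{\alpha_k}\,e^{(i_1+t)\beta_1z}\cdots e^{(i_k+t)\beta_kz}.$$ For each monomial in $X$, its coefficient is an absolutely convergent series. It is expanded as a Laurent series in $z$ whose coefficients are polynomials in $t$. The result is then rewritten as a formal object by collecting powers of $z$ and of $t$. The element so obtained is $\phi\binom{\alpha}{\beta}$. *)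

(* Defs.v *)
From HB Require Import structures.
From mathcomp Require Import all_boot all_order all_algebra.
From mathcomp Require Import classical_sets reals topology normedtype sequences exp trigo.
From mathcomp Require Import complex.
Set Implicit Arguments. Unset Strict Implicit. Unset Printing Implicit Defensive.
Import Order.TTheory GRing.Theory Num.Theory numFieldNormedType.Exports.
Local Open Scope ring_scope.
Local Open Scope classical_set_scope.
Local Open Scope complex_scope.

(* The usual (norm) topology on the complex numbers R[i]. *)
HB.instance Definition _ (R : realType) := PseudoPointedMetric.copy R[i] (R[i])^o.

(* Letters (alpha, beta) : columns of the matrices binom(alpha, beta). *)
Definition letter := (nat * nat)%type.
Definition word := seq letter.

(* basis elements of H = QS(N x P): beta_i >= 1 *)
Definition Hword (w : word) : bool := all (fun l : letter => (0 < l.2)%N) w.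
(* index of a Stirling left weak quasisymmetric function: k = 0 or alpha_k > 0 *)
Definition Gword (w : word) : bool := (w == [::]) || (0 < (last (0%N, 0%N) w).1)%N.

(* Monomials in X = {x_1, x_2, ...}: exponent sequences (entry j is the
   exponent of x_(j+1)) without trailing zeros. *)
Fixpoint mnorm (s : seq nat) : seq nat :=
  match s with
  | [::] => [::]
  | a :: s' => let r := mnorm s' in
               if (a == 0%N) && (r == [::]) then [::] else a :: r
  end.

Definition canon (s : seq nat) : bool := last 1%N s != 0%N.

Lemma canon_mnorm s : canon (mnorm s).
Proof.
rewrite /canon; elim: s => [|a s IH] //=.
case: (mnorm s) IH => [|b r] /= IH.
  by case: a.
by rewrite andbF.
Qed.

Definition mono := {s : seq nat | canon s}.
Definition mkmono (s : seq nat) : mono := exist _ (mnorm s) (canon_mnorm s).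

Fixpoint addl (s t : seq nat) : seq nat :=
  match s, t with
  | [::], _ => t
  | _, [::] => s
  | a :: s', b :: t' => (a + b)%N :: addl s' t'
  end.
Fixpoint subl (s t : seq nat) : seq nat :=
  match s, t with
  | [::], _ => [::]
  | _, [::] => s
  | a :: s', b :: t' => (a - b)%N :: subl s' t'
  end.
Fixpoint below (s : seq nat) : seq (seq nat) :=
  match s with
  | [::] => [:: [::]]
  | a :: s' => flatten [seq [seq b :: r | r <- below s'] | b <- iota 0 a.+1]
  end.

Fixpoint incs (s : seq nat) (k : nat) : seq (seq nat) :=
  match k, s with
  | 0%N, _ => [:: [::]]
  | k'.+1, [::] => [::]
  | k'.+1, x :: s' => [seq x :: r | r <- incs s' k'] ++ incs s' k
  end.

(* exponent sequence of x_(i_1)^(alpha_1) ... x_(i_k)^(alpha_k) *)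
Definition unitexp (i a : nat) : seq nat := rcons (nseq i.-1 0%N) a.
Definition expo (I : seq nat) (w : word) : seq nat :=
  foldr addl [::] [seq unitexp p.1 p.2.1 | p <- zip I w].

(* Q[[X]]-coefficient of x^m in hat M_(alpha; beta) (w a Gword).  Since
   alpha_k > 0 (or k = 0), all indices of a contributing tuple lie in
   [1, size m], so the defining sum is this finite sum. *)
Definition Mhat (w : word) (m : mono) : rat :=
  \sum_(I <- incs (iota 1 (size (val m))) (size w))
     (if mkmono (expo I w) == m
      then \prod_(p <- zip I w) ((p.1 ^ p.2.2)%N)%:R else 0).

Definition inGSym (f : mono -> rat) : Prop :=
  exists L : seq (rat * word), all (fun x => Gword x.2) L /\
    forall m, f m = \sum_(x <- L) x.1 * Mhat x.2 m.

(* Formal objects: F m n = coefficient of x^m z^n, a polynomial in t. *)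
Definition fser := mono -> int -> {poly rat}.

Definition in_GSym_t_Laurent (F : fser) : Prop :=
  (exists N : nat, forall m n, n < - (N%:Z) -> F m n = 0) /\
  forall n : int,
    (exists D : nat, forall m, (size (F m n) <= D)%N) /\
    forall j : nat, inGSym (fun m => (F m n)`_j).

Definition in_GSym_t_pow (F : fser) : Prop :=
  in_GSym_t_Laurent F /\ forall m n, n < 0 -> F m n = 0.

Definition fone : fser :=
  fun m n => if (val m == [::]) && (n == 0) then 1 else 0.

Definition fmul_trunc (F G : fser) (K : nat) (m : mono) (n : int) : {poly rat} :=
  \sum_(s <- below (val m)) \sum_(i < K.*2.+1)
     F (mkmono s) (i%:Z - K%:Z) * G (mkmono (subl (val m) s)) (n - (i%:Z - K%:Z)).

(* P is the product F * G (for Laurent series in z: the truncated products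
   stabilize to the product coefficient) *)
Definition is_fprod (F G P : fser) : Prop :=
  forall m n, exists K0 : nat, forall K : nat, (K0 <= K)%N -> P m n = fmul_trunc F G K m n.

Fixpoint qsh (a b : word) {struct a} : seq word :=
  match a with
  | [::] => [:: b]
  | x :: a' =>
    let fix qsh_a (b : word) : seq word :=
      match b with
      | [::] => [:: a]
      | y :: b' => map (cons x) (qsh a' b) ++ map (cons y) (qsh_a b')
                   ++ map (cons (x.1 + y.1, x.2 + y.2)%N) (qsh a' b')
      end in qsh_a b
  end.

(* elements of H: finite Q-linear combinations of words *)
Definition hcomb := seq (rat * word).
Definition qmul (u v : hcomb) : hcomb :=
  flatten [seq [seq (x.1 * y.1, w) | w <- qsh x.2 y.2] | x <- u, y <- v].
Definition hlin (Phi : word -> fser) (u : hcomb) : fser :=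
  fun m n => \sum_(x <- u) x.1 *: Phi x.2 m n.

Definition cexp (R : realType) (w : R[i]) : R[i] :=
  let: a +i* b := w in (expR a)%:C * ((cos b)%:C + 'i * (sin b)%:C).

Definition phi_partial (R : realType) (w : word) (m : mono) (t : R) (z : R[i])
    (L : nat) : R[i] :=
  \sum_(I <- incs (iota 1 L) (size w))
     (if mkmono (expo I w) == m
      then \prod_(p <- zip I w) cexp ((p.1%:R + t%:C) * (p.2.2)%:R * z)
      else 0).

Definition laurent_partial (R : realType) (F : fser) (m : mono) (N : nat)
    (t : R) (z : R[i]) (K : nat) : R[i] :=
  \sum_(i < K) ((map_poly ratr (F m (i%:Z - N%:Z))).[t])%:C * z ^ (i%:Z - N%:Z).

(* F is phi(w): for every monomial x^m, the coefficient series (over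
   0 < i_1 < ... < i_k) converges, and equals, for Re z < 0 and |z| small,
   the Laurent series in z whose coefficients (F m n)(t) are polynomials in t. *)
Definition is_regularization (R : realType) (w : word) (F : fser) : Prop :=
  forall m : mono, exists N : nat,
    (forall n : int, n < - (N%:Z) -> F m n = 0) /\
    forall t : R, 0 <= t -> exists r : R, 0 < r /\
      forall z : R[i], complex.Re z < 0 -> `|z| < r%:C ->
        exists v : R[i],
          (phi_partial w m t z L @[L --> \oo] --> v) /\
          (laurent_partial F m N t z K @[K --> \oo] --> v).

(* Main.v *)
(* Truncated to x_1, ..., x_L, the sums phi(w) are quasi-shuffle characters, so
   their limits are multiplicative; the homomorphism property then follows from
   the uniqueness of Laurent expansions on a half disc and of polynomials with
   given values at all t >= 0.  For the expansion itself write w = u v, where v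
   is the longest suffix with all alpha_i = 0.  On a fixed monomial only finitely
   many indices fit u, and the last of them is the size of the monomial; the sum
   over the indices of v is an iterated geometric series, equal to an
   exponential times a product of factors e^(b z) / (1 - e^(c z)) with c > 0.
   Hence the pole has order at most the length of v, and the coefficient of
   z^n t^j is a combination of powers of linear forms in the indices of u.
   Multiplying by an index raises one exponent beta_s of hat M, so it stays in
   GSym. *)
Require Import Defs.
From HB Require Import structures.
From mathcomp Require Import all_boot all_order all_algebra.
From mathcomp Require Import classical_sets reals topology normedtype sequences exp trigo.
From mathcomp Require Import complex.
From mathcomp Require Import ring lra zify.
Set Implicit Arguments. Unset Strict Implicit. Unset Printing Implicit Defensive.
Import Order.TTheory GRing.Theory Num.Theory numFieldNormedType.Exports.
Local Open Scope ring_scope.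
Local Open Scope classical_set_scope.
Local Open Scope complex_scope.

(** * Limits and power series over R[i] *)

(** A regularization may have a pole bound that varies with the monomial, whereas membership in
    GSym[t][z^-1,z]] asks for bounds on the pole order and on the degree in t that are uniform over
    all monomials. So nothing is read off an abstract regularization: the explicit series [regser]
    has uniform bounds, and uniqueness identifies every regularization with it. The sums converge
    for Re z < 0 only, so 0 lies on the boundary of the domain. Products and uniqueness of
    expansions rest on one remark: convergence at a single point of the half disc already bounds the
    coefficients geometrically. Laurent series are multiplied by z^N and treated as power series.
    The radius may depend on t and on the monomial, since only identities between coefficients are
    extracted. Coefficients stay rational because (1 - e^(kz))/z is inverted as a formal series over
    [rat]. Tuples of indices are replaced by the recursion [wsum], which decides index by index; the
    quasi-shuffle identity and the geometric series of the tail then both come from one unfolding of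
    it. *)

(* Convergence in R[i], boxed so that unification never unfolds the topology. *)
Variant ccvg (R : realType) (u : nat -> R[i]) (a : R[i]) : Prop :=
  Ccvg of (u : nat -> R[i]^o) n @[n --> \oo] --> (a : R[i]^o).

Lemma ccvgE (R : realType) (u : nat -> R[i]) (a : R[i]) :
  ccvg u a <-> ((u : nat -> R[i]^o) n @[n --> \oo] --> (a : R[i]^o)).
Proof. by split=> [[]|]. Qed.

Section ComplexLimits.
Variable R : realType.
Local Notation C := R[i].
Implicit Types (u v : nat -> C) (a b : C).

(** In the partial order of R[i] a positive element has imaginary part 0, so real radii suffice. *)
Lemma ccvgP u a : ccvg u a <-> forall e : R, 0 < e -> exists N, forall n, (N <= n)%N -> `|a - u n| < e%:C.
Proof.
split.
  move=> [] /(@cvgrPdist_lt C C^o nat) => h e e0.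
  have e0' : 0 < e%:C :> C by rewrite ltcR.
  have [N _ hN] := h _ e0'.
  by exists N => n /hN.
move=> h; constructor; apply/(@cvgrPdist_lt C C^o nat) => -[x y] /=.
rewrite ltcE /= => /andP[/eqP -> x0].
by have [N hN] := h _ x0; exists N => // n /hN.
Qed.

Lemma ccvgM u v a b : ccvg u a -> ccvg v b -> ccvg (fun n => u n * v n) (a * b).
Proof. by move=> [hu] [hv]; constructor; exact: (@cvgM C nat _ _ _ _ _ _ hu hv). Qed.
Lemma ccvgD u v a b : ccvg u a -> ccvg v b -> ccvg (fun n => u n + v n) (a + b).
Proof. by move=> [hu] [hv]; constructor; exact: (@cvgD C C^o nat _ _ _ _ _ _ hu hv). Qed.
Lemma ccvg_cst a : ccvg (fun=> a) a.
Proof. by constructor; exact: (@cvg_cst C^o a nat). Qed.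
Lemma ccvgV u a : a != 0 -> ccvg u a -> ccvg (fun n => (u n)^-1) a^-1.
Proof. by move=> a0 [hu]; constructor; exact: (@cvgV C nat _ _ _ _ a0 hu). Qed.
Lemma ccvg_unique u a b : ccvg u a -> ccvg u b -> a = b.
Proof. by move=> [ha] [hb]; exact: (@cvg_unique C^o (@norm_hausdorff C C^o) _ _ _ _ ha hb). Qed.
Lemma ccvg_shift u a : ccvg (fun n => u n.+1) a <-> ccvg u a.
Proof. by rewrite !ccvgE (@cvg_shiftS C^o u). Qed.

Lemma ccvg_sum (I : Type) (s : seq I) (P : pred I) (f : I -> nat -> C) (g : I -> C) :
  (forall i, ccvg (f i) (g i)) ->
  ccvg (fun n => \sum_(i <- s | P i) f i n) (\sum_(i <- s | P i) g i).
Proof.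
move=> h; elim: s => [|i s IH].
  by rewrite big_nil (_ : (fun n => _) = fun=> 0); [exact: ccvg_cst|apply/boolp.funext => n; rewrite big_nil].
rewrite big_cons (_ : (fun n => _) = fun n => if P i then f i n + \sum_(i <- s | P i) f i n else \sum_(i <- s | P i) f i n).
  by case: (P i); [exact: (ccvgD (h i) IH)|exact: IH].
by apply/boolp.funext => n; rewrite big_cons.
Qed.

Lemma ccvg_bounded u a : ccvg u a -> exists2 B : R, 0 < B & forall n, `|u n| <= B%:C.
Proof.
move=> /ccvgP /(_ 1 ltr01) [N hN].
(* A nonnegative element of R[i] is real, so taking the real part loses nothing. *)
pose B : R := complex.Re (`|a| + 1 + \sum_(i < N) `|u i|).
have hB : B%:C = `|a| + 1 + \sum_(i < N) `|u i|.
  have : 0 <= `|a| + 1 + \sum_(i < N) `|u i| :> C.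
    by rewrite !addr_ge0 ?normr_ge0 ?ler01 //; apply: sumr_ge0.
  by rewrite /B; case: (_ + _ + _) => x y; rewrite lecE /= => /andP[/eqP ->].
have hS : 0 <= \sum_(i < N) `|u i| :> C by apply: sumr_ge0.
exists B.
  rewrite -ltcR hB; apply: ltr_wpDr => //; apply: ltr_wpDl => //.
move=> n; rewrite hB; case: (ltnP n N) => hn.
  rewrite (bigD1 (Ordinal hn)) //= addrCA lerDl.
  by rewrite addr_ge0 ?addr_ge0 //; apply: sumr_ge0.
apply: le_trans (_ : `|a| + 1 <= _); last by rewrite lerDl.
have -> : u n = a - (a - u n) by ring.
apply: le_trans (ler_normB _ _) _; rewrite lerD2l.
exact: ltW (hN _ hn).
Qed.


Lemma eq_ccvg u v a : (forall n, u n = v n) -> ccvg u a -> ccvg v a.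
Proof. by move=> /boolp.funext ->. Qed.

End ComplexLimits.

(** * Power series on a left half disc: products, uniqueness, inverses *)

Section PowerSeries.
Variable R : realType.
Local Notation C := R[i].
Implicit Types (u v a b c : nat -> C) (f g : C -> C) (z w : C).

(** The norm of R[i] has its values in R[i]; [nrm] is the same number in R, where the order is
    total. *)
Definition nrm z : R := complex.Re `|z|.

Lemma nrmE z : `|z| = (nrm z)%:C.
Proof. by rewrite /nrm normc_def. Qed.
Lemma nrm_ge0 z : 0 <= nrm z.
Proof. by rewrite -(lecR 0) -nrmE normr_ge0. Qed.
Lemma nrmM z w : nrm (z * w) = nrm z * nrm w.
Proof. by apply: (@complexI R); rewrite rmorphM -!nrmE normrM. Qed.
Lemma nrmX z n : nrm (z ^+ n) = nrm z ^+ n.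
Proof. by apply: (@complexI R); rewrite rmorphXn -!nrmE normrX. Qed.
Lemma nrm0 : nrm 0 = 0.
Proof. by apply: (@complexI R); rewrite -nrmE normr0. Qed.
Lemma nrm_gt0 z : (0 < nrm z) = (z != 0).
Proof. by rewrite -(ltcR 0) -nrmE normr_gt0. Qed.
Lemma nrmV z : nrm z^-1 = (nrm z)^-1.
Proof. by apply: (@complexI R); rewrite fmorphV -!nrmE normfV. Qed.
Lemma nrmN z : nrm (- z) = nrm z.
Proof. by rewrite /nrm normrN. Qed.
Lemma nrmBC z w : nrm (z - w) = nrm (w - z).
Proof. by rewrite /nrm distrC. Qed.
Lemma ler_nrmD z w : nrm (z + w) <= nrm z + nrm w.
Proof. by rewrite -lecR rmorphD -!nrmE ler_normD. Qed.
Lemma ler_nrmB z w : nrm (z - w) <= nrm z + nrm w.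
Proof. by rewrite -(nrmN w) ler_nrmD. Qed.
Lemma nrm_real (x : R) : nrm x%:C = `|x|.
Proof. by apply: (@complexI R); rewrite -nrmE normc_def /= expr0n addr0 sqrtr_sqr. Qed.
Lemma nrm_sum (I : Type) (s : seq I) (P : pred I) (F : I -> C) :
  nrm (\sum_(i <- s | P i) F i) <= \sum_(i <- s | P i) nrm (F i).
Proof.
elim/big_rec2 : _ => [|i x z _ h]; first by rewrite nrm0.
by apply: le_trans (ler_nrmD _ _) _; rewrite lerD2l.
Qed.

Lemma ccvg_nrmP u z : ccvg u z <-> forall e : R, 0 < e -> exists N, forall n, (N <= n)%N -> nrm (u n - z) < e.
Proof.
split=> [/ccvgP h e /h [N hN]|h]; last apply/ccvgP => e /h [N hN].
  by exists N => n /hN; rewrite distrC nrmE ltcR.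
by exists N => n /hN; rewrite distrC nrmE ltcR.
Qed.

Lemma half_pow_lt (M e : R) : 0 < e -> exists N, forall n, (N <= n)%N -> M * (1 / 2) ^+ n < e.
Proof.
move=> e0; pose N := Num.bound (M / e); exists N => n hn.
have [M0|M0] := leP M 0.
  by apply: le_lt_trans e0; apply: mulr_le0_ge0 => //; rewrite exprn_ge0 ?divr_ge0.
have h : M / e < N%:R by apply: archi_boundP; rewrite divr_ge0 ?ltW.
rewrite expr_div_n expr1n mul1r ltr_pdivrMr ?exprn_gt0 //.
rewrite ltr_pdivrMr // mulrC in h; apply: lt_trans h _.
by rewrite ltr_pM2l // -natrX ltr_nat; apply: leq_ltn_trans hn _; apply: ltn_expl.
Qed.

Lemma ccvg_geom u z M : (forall n, nrm (u n - z) <= M * (1 / 2) ^+ n) -> ccvg u z.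
Proof.
move=> h; apply/ccvg_nrmP => e /(half_pow_lt M) [N hN]; exists N => n /hN.
exact: le_lt_trans (h n).
Qed.

Definition conv (T : pzSemiRingType) (a b : nat -> T) n := \sum_(i < n.+1) a i * b (n - i)%N.

Lemma sum_conv (T : pzRingType) (a b : nat -> T) K :
  \sum_(k < K) conv a b k = \sum_(0 <= i < K) a i * \sum_(0 <= j < K - i) b j.
Proof.
elim: K => [|K IH]; first by rewrite big_ord0 big_geq.
rewrite big_ord_recr /= IH [in RHS]big_nat_recr //= subSnn big_nat1.
rewrite /conv big_ord_recr /= subnn addrA; congr (_ + _).
rewrite -(big_mkord xpredT (fun i => a i * b (K - i)%N)) -big_split /=.
apply: eq_big_nat => i /andP[_ hi]; rewrite -mulrDr subSn ?(ltnW hi) //.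
by rewrite big_nat_recr.
Qed.

(** The Cauchy product covers the triangle i + j < K of the square i, j < K. Each missing term is at
    most M N q^K, and there are at most K^2 <= 4^K of them; q <= 1/8 turns 4^K q^K into 2^-K. *)
Lemma cauchy_product_bound u v (M N q : R) K : 0 <= q <= 1 / 8 -> 0 <= M -> 0 <= N ->
  (forall i, nrm (u i) <= M * q ^+ i) -> (forall i, nrm (v i) <= N * q ^+ i) ->
  nrm (\sum_(k < K) conv u v k - (\sum_(i < K) u i) * (\sum_(j < K) v j)) <= M * N * (1 / 2) ^+ K.
Proof.
move=> /andP[q0 q1] M0 N0 hu hv.
have -> : \sum_(k < K) conv u v k - (\sum_(i < K) u i) * (\sum_(j < K) v j)
   = - \sum_(0 <= i < K) u i * \sum_(K - i <= j < K) v j.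
  rewrite sum_conv -(big_mkord xpredT u) -(big_mkord xpredT v) mulr_suml -sumrB -sumrN.
  apply: eq_big_nat => i /andP[_ hi].
  by rewrite (@big_cat_nat _ _ _ (K - i)%N 0 K) ?leq_subr //= mulrDr opprD addrA subrr add0r.
rewrite nrmN; apply: le_trans (nrm_sum _ _ _) _.
have q1' : q <= 1 by lra.
have hq n : 0 <= q ^+ n by rewrite exprn_ge0.
apply: le_trans (_ : \sum_(0 <= i < K) M * N * (K%:R * q ^+ K) <= _).
  apply: ler_sum_nat => i /andP[_ hi]; rewrite nrmM.
  apply: le_trans (_ : M * q ^+ i * \sum_(K - i <= j < K) N * q ^+ (K - i) <= _).
    apply: ler_pM; rewrite ?nrm_ge0 //.
    apply: le_trans (nrm_sum _ _ _) _; apply: ler_sum_nat => j /andP[hj _].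
    by apply: le_trans (hv j) _; apply: ler_wpM2l => //; apply: ler_wiXn2l.
  rewrite sumr_const_nat subKn ?(ltnW hi) // -[X in _ <= _ * (_ * q ^+ X)](subnKC (ltnW hi)) exprD.
  rewrite -mulr_natl.
  have : (i%:R : R) <= K%:R by rewrite ler_nat ltnW.
  move=> h; have := ler_wpM2l (mulr_ge0 (mulr_ge0 M0 N0) (mulr_ge0 (hq i) (hq (K - i)%N))) h.
  by lra.
rewrite sumr_const_nat subn0 -mulr_natl.
have h1 : K%:R * (K%:R * q ^+ K) <= (1 / 2) ^+ K.
  have hK : (K%:R : R) <= 2 ^+ K by rewrite -natrX ler_nat ltnW // ltn_expl.
  apply: le_trans (_ : 2 ^+ K * (2 ^+ K * (1 / 8) ^+ K) <= _).
    apply: ler_pM => //; first by rewrite mulr_ge0.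
    by apply: ler_pM => //; apply: lerXn2r => //; rewrite ?nnegrE ?divr_ge0.
  by rewrite -!exprMn; have -> : 2 * (2 * (1 / 8)) = 1 / 2 :> R by lra.
have := ler_wpM2l (mulr_ge0 M0 N0) h1; lra.
Qed.

Lemma ccvg_conv u v (M N q : R) z w : 0 <= q <= 1 / 8 -> 0 <= M -> 0 <= N ->
  (forall i, nrm (u i) <= M * q ^+ i) -> (forall i, nrm (v i) <= N * q ^+ i) ->
  ccvg (fun K => \sum_(i < K) u i) z -> ccvg (fun K => \sum_(i < K) v i) w ->
  ccvg (fun K => \sum_(i < K) conv u v i) (z * w).
Proof.
move=> hq M0 N0 hu hv hz hw.
have h0 : ccvg (fun K => \sum_(k < K) conv u v k - (\sum_(i < K) u i) * (\sum_(j < K) v j)) 0.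
  by apply: (@ccvg_geom _ _ (M * N)) => K; rewrite subr0; exact: (@cauchy_product_bound u v M N q K).
have := ccvgD h0 (ccvgM hz hw); rewrite add0r; apply: eq_ccvg => K.
by rewrite subrK.
Qed.

Definition psum a z (K : nat) : C := \sum_(i < K) a i * z ^+ i.

(* [f] is only constrained near 0 in the left half plane, where [phi] is defined. *)
Definition exps a f : Prop := exists2 r : R, 0 < r &
  forall z, complex.Re z < 0 -> nrm z < r -> ccvg (psum a z) (f z).

(** Convergence at the one point -r/2 bounds the partial sums by some B, hence each term, a
    difference of two of them, by 2B. *)
Lemma exps_bound a f : exps a f ->
  exists M q : R, [/\ 0 < M, 0 < q & forall i, nrm (a i) <= M * q ^+ i].
Proof.
move=> [r r0 h].
pose z0 : C := (- (r / 2))%:C.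
have nz0 : nrm z0 = r / 2 by rewrite nrm_real normrN ger0_norm //; lra.
have hz : ccvg (psum a z0) (f z0) by apply: h; [rewrite /=; lra|rewrite nz0; lra].
have [B B0 hB] := ccvg_bounded hz.
exists (2 * B), (2 / r); split; [lra|by rewrite divr_gt0|move=> i].
have hi : nrm (a i) * (r / 2) ^+ i <= 2 * B.
  rewrite -nz0 -nrmX -nrmM.
  have -> : a i * z0 ^+ i = psum a z0 i.+1 - psum a z0 i.
    by rewrite /psum big_ord_recr /= addrAC subrr add0r.
  apply: le_trans (ler_nrmB _ _) _.
  have := hB i; have := hB i.+1; rewrite !nrmE !lecR; lra.
have -> : 2 / r = (r / 2)^-1 by rewrite invf_div.
by rewrite exprVn ler_pdivlMr // exprn_gt0 // divr_gt0.
Qed.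

Lemma eq_exps a b f g : (forall n, a n = b n) ->
  (forall z, complex.Re z < 0 -> f z = g z) -> exps a f -> exps b g.
Proof.
move=> /boolp.funext -> hf [r r0 h]; exists r => // z z0 zr.
by rewrite -hf //; apply: h.
Qed.

Lemma exps_mul a b f g : exps a f -> exps b g -> exps (conv a b) (fun z => f z * g z).
Proof.
move=> ha hb; have [M [p [M0 p0 hM]]] := exps_bound ha.
have [N [q [N0 q0 hN]]] := exps_bound hb.
case: ha hb => r r0 ha [s s0 hb].
(* Inside this radius |z| (p + q) < 1/8, and both series are dominated by the geometric series of
   that ratio, as [ccvg_conv] requires. *)
exists (Num.min (Num.min r s) (1 / 8 / (p + q))).
  by rewrite !lt_min r0 s0 /=; apply: divr_gt0; [lra|exact: addr_gt0].
move=> z z0; rewrite !lt_min => /andP[/andP[zr zs] zq].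
have hzq : nrm z * (p + q) < 1 / 8 by rewrite -ltr_pdivlMr // addr_gt0.
have nz := nrm_ge0 z.
have aux (t : R) (L : R) x i : 0 < L -> 0 < t -> t <= p + q -> nrm x <= L * t ^+ i ->
    nrm (x * z ^+ i) <= L * (nrm z * (p + q)) ^+ i.
  move=> L0 t0 tpq hx; rewrite nrmM nrmX exprMn [_ ^+ i * (p + q) ^+ i]mulrC mulrA.
  apply: ler_wpM2r; first by rewrite exprn_ge0.
  apply: le_trans hx _; apply: ler_wpM2l; first exact: ltW.
  by apply: lerXn2r => //; rewrite nnegrE; lra.
have hc : ccvg (fun K => \sum_(k < K) conv (fun i => a i * z ^+ i) (fun i => b i * z ^+ i) k)
    (f z * g z); last apply: eq_ccvg hc.
  apply: (@ccvg_conv _ _ M N (nrm z * (p + q)) _ _ _ (ltW M0) (ltW N0)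
    _ _ (ha _ z0 zr) (hb _ z0 zs)).
  - by rewrite mulr_ge0 ?(ltW hzq) // addr_ge0 ?ltW.
  - by move=> i; apply: aux (hM i) => //; lra.
  - by move=> i; apply: aux (hN i) => //; lra.
- move=> K; rewrite /psum; apply: eq_bigr => k _; rewrite /conv mulr_suml.
  apply: eq_bigr => i _; rewrite mulrACA -exprD subnKC //.
  by rewrite -ltnS.
Qed.

Lemma exps_unshift a f : exps a f -> a 0%N = 0 -> exps (fun n => a n.+1) (fun z => f z / z).
Proof.
move=> [r r0 h] a0; exists r => // z z0 zr.
have zn0 : z != 0 by apply: contraTneq z0 => ->; rewrite ltxx.
apply: eq_ccvg (ccvgM ((ccvg_shift _ _).2 (h _ z0 zr)) (ccvg_cst z^-1)) => n.
rewrite /psum big_ord_recl a0 mul0r add0r mulr_suml; apply: eq_bigr => i _.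
by rewrite /= exprSr mulrA mulfK.
Qed.

Definition delay a n : C := if n is n'.+1 then a n' else 0.

Lemma exps_delay a f : exps a f -> exps (delay a) (fun z => z * f z).
Proof.
move=> [r r0 h]; exists r => // z z0 zr; apply/ccvg_shift.
apply: eq_ccvg (ccvgM (ccvg_cst z) (h _ z0 zr)) => n.
rewrite /psum big_ord_recl /= mul0r add0r mulr_sumr; apply: eq_bigr => i _.
by rewrite /= exprS mulrCA.
Qed.

Lemma exps_sum (I : Type) (s : seq I) (a : I -> nat -> C) (f : I -> C -> C) :
  (forall i, exps (a i) (f i)) ->
  exps (fun n => \sum_(i <- s) a i n) (fun z => \sum_(i <- s) f i z).
Proof.
move=> h; elim: s => [|i s [r r0 IH]].
  exists 1 => // z _ _; rewrite big_nil; apply: (eq_ccvg _ (ccvg_cst _)) => n.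
  by rewrite /psum big1 // => i _; rewrite big_nil mul0r.
have [p p0 hp] := h i; exists (Num.min r p); first by rewrite lt_min r0.
move=> z z0; rewrite lt_min => /andP[zr zp]; rewrite big_cons.
apply: eq_ccvg (ccvgD (hp _ z0 zp) (IH _ z0 zr)) => n.
by rewrite /psum -big_split; apply: eq_bigr => j _; rewrite big_cons mulrDl.
Qed.

Lemma exps_scale (k : C) a f : exps a f -> exps (fun n => k * a n) (fun z => k * f z).
Proof.
move=> [r r0 h]; exists r => // z z0 zr.
apply: eq_ccvg (ccvgM (ccvg_cst k) (h _ z0 zr)) => n.
by rewrite /psum mulr_sumr; apply: eq_bigr => i _; rewrite mulrA.
Qed.

Lemma exps_add a b f g : exps a f -> exps b g -> exps (fun n => a n + b n) (fun z => f z + g z).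
Proof.
move=> ha hb.
have [] := @exps_sum bool [:: true; false] (fun i => if i then a else b) (fun i => if i then f else g).
  by case.
move=> r r0 h.
exists r => // z z0 zr; have := h z z0 zr; rewrite !big_cons big_nil addr0.
by apply: eq_ccvg => n; apply: eq_bigr => i _; rewrite !big_cons big_nil addr0.
Qed.

Lemma exps_const (k : C) : exps (fun n => if n == 0%N then k else 0) (fun=> k).
Proof.
exists 1 => // z z0 z1; apply/ccvg_shift; apply: (eq_ccvg _ (ccvg_cst k)) => n.
by rewrite /psum big_ord_recl /= mulr1 big1 ?addr0 // => i _; rewrite mul0r.
Qed.

Lemma exps0_head a f : (forall z, f z = 0) -> exps a f -> a 0%N = 0.
Proof.
move=> f0 ha; have [M [q [M0 q0 hM]]] := exps_bound ha.
case: ha => r r0 ha; apply/eqP; apply: contraT; rewrite -nrm_gt0 => na.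
set e := nrm (a 0%N) in na.
(* At z = -x the three bounds keep z in the disc, make q x <= 1/2 so that the tail is at most 2 M q
   x, and make this at most e/2. A partial sum smaller than e/4 then contradicts |a_0| = e. *)
pose x := Num.min (Num.min (r / 2) (1 / 2 / q)) (e / (4 * M * q)).
have x0 : 0 < x by rewrite !lt_min !divr_gt0 ?mulr_gt0.
have [xr xq xe] : [/\ x <= r / 2, x <= 1 / 2 / q & x <= e / (4 * M * q)].
  by split; rewrite !ge_min lexx ?orbT.
pose z : C := (- x)%:C.
have nz : nrm z = x by rewrite nrm_real normrN gtr0_norm.
have hz : ccvg (psum a z) 0.
  by rewrite -(f0 z); apply: ha; [rewrite /= oppr_lt0|rewrite nz; lra].
have [n hn] := (ccvg_nrmP _ _).1 hz (e / 4) (divr_gt0 na (ltr0n _ 4)).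
have {hn} := hn n.+1 (leqnSn n); rewrite subr0 /psum big_ord_recl /= mulr1 => h1.
have xq' : q * x <= 1 / 2 by rewrite mulrC -ler_pdivlMr.
have qx0 : 0 < q * x by rewrite mulr_gt0.
have h2 : nrm (\sum_(i < n) a (lift ord0 i) * z ^+ (lift ord0 i)) <= M * (2 * (q * x)).
  apply: le_trans (nrm_sum _ _ _) _.
  apply: le_trans (_ : \sum_(i < n) M * (q * x) * (1 / 2) ^+ i <= _).
    apply: ler_sum => i _; rewrite nrmM nrmX nz lift0.
    apply: le_trans (_ : M * q ^+ i.+1 * x ^+ i.+1 <= _).
      by apply: ler_wpM2r; [rewrite exprn_ge0 // ltW|apply: hM].
    have -> : M * q ^+ i.+1 * x ^+ i.+1 = M * (q * x) * (q * x) ^+ i.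
      by rewrite exprMn !exprS; ring.
    apply: ler_wpM2l; first by rewrite mulr_ge0 ?ltW.
    by apply: lerXn2r => //; rewrite nnegrE ?divr_ge0 // ltW.
  have hg : \sum_(i < n) (1 / 2 : R) ^+ i = 2 - 2 * (1 / 2) ^+ n.
    elim: n {h1} => [|n IH]; first by rewrite big_ord0 expr0; lra.
    by rewrite big_ord_recr /= IH exprS; lra.
  rewrite -mulr_sumr hg.
  have hp : 0 <= (1 / 2 : R) ^+ n by rewrite exprn_ge0 // divr_ge0.
  have := mulr_ge0 (mulr_ge0 (ltW M0) (ltW qx0)) hp; lra.
have h3 : M * (2 * (q * x)) <= e / 2.
  move: xe; rewrite ler_pdivlMr ?mulr_gt0 // => xe; lra.
have := ler_nrmB (a 0%N + \sum_(i < n) a (lift ord0 i) * z ^+ lift ord0 i)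
  (\sum_(i < n) a (lift ord0 i) * z ^+ lift ord0 i).
by rewrite addrK -/e => h4; lra.
Qed.

(** Once the constant term vanishes, division by z moves every coefficient down one place and leaves
    the function 0. *)
Lemma exps0 a f : (forall z, f z = 0) -> exps a f -> forall n, a n = 0.
Proof.
move=> f0 ha n; elim: n a f f0 ha => [|n IH] a f f0 ha; first exact: exps0_head ha.
apply: (IH (fun n => a n.+1) (fun z => f z / z)) => [z|]; first by rewrite f0 mul0r.
by apply: exps_unshift => //; apply: exps0_head ha.
Qed.

Lemma exps_unique a b f : exps a f -> exps b f -> forall n, a n = b n.
Proof.
move=> ha hb n; apply/eqP; rewrite -subr_eq0; apply/eqP.
have h := exps_add ha (exps_scale (-1) hb).
by rewrite -mulN1r; apply: (exps0 _ h) => z; rewrite mulN1r subrr.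
Qed.

Lemma conv_inv_bound b c (M q : R) : 0 < M -> 0 < q ->
  (forall i, nrm (b i) <= M * q ^+ i) -> b 0%N != 0 ->
  (forall n, conv b c n = (n == 0%N)%:R) ->
  exists2 s : R, 0 < s & forall n, nrm (c n) <= nrm (c 0%N) * s ^+ n.
Proof.
move=> M0 q0 hb b0 hc; pose L := M / nrm (b 0%N).
have nb0 : 0 < nrm (b 0%N) by rewrite nrm_gt0.
have L0 : 0 < L by rewrite divr_gt0.
(* The recursion c_(n+1) = - b_0^-1 sum_i b_(i+1) c_(n-i) loses a factor L at each use; the ratio 1
   + L absorbs it because L sum_(i<=n) (1 + L)^i = (1 + L)^(n+1) - 1. *)
exists (q * (1 + L)); first by rewrite mulr_gt0 // addr_gt0.
elim/ltn_ind => -[|n] IH; first by rewrite mulr1.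
have hn : c n.+1 = - (b 0%N)^-1 * \sum_(i < n.+1) b i.+1 * c (n - i)%N.
  have := hc n.+1; rewrite /conv big_ord_recl /= => /eqP; rewrite addr_eq0 => /eqP h.
  by apply: (mulfI b0); rewrite h mulNr mulrN mulVKf.
rewrite hn nrmM nrmN nrmV ler_pdivrMl //.
apply: le_trans (nrm_sum _ _ _) _.
apply: le_trans (_ : \sum_(i < n.+1) M * nrm (c 0%N) * q ^+ n.+1 * (1 + L) ^+ (n - i) <= _).
  apply: ler_sum => i _; rewrite nrmM.
  have hi : (i <= n)%N by rewrite -ltnS.
  apply: le_trans (_ : M * q ^+ i.+1 * (nrm (c 0%N) * (q * (1 + L)) ^+ (n - i)) <= _).
    apply: ler_pM; rewrite ?nrm_ge0 //; apply: IH.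
    by rewrite ltnS leq_subr.
  have -> : q ^+ n.+1 = q ^+ i.+1 * q ^+ (n - i) by rewrite -exprD addSn subnKC.
  by rewrite exprMn le_eqVlt; apply/orP; left; apply/eqP; ring.
rewrite -mulr_sumr.
have hg : L * \sum_(i < n.+1) (1 + L) ^+ (n - i) = (1 + L) ^+ n.+1 - 1.
  rewrite (reindex_inj rev_ord_inj) /=.
  rewrite (eq_bigr (fun i : 'I_n.+1 => (1 + L) ^+ i)); last first.
    by move=> i _; rewrite subSS subKn // -ltnS.
  elim: n {IH hn} => [|n IHn]; first by rewrite big_ord1 expr0 expr1; lra.
  by rewrite big_ord_recr /= mulrDr IHn [(1 + L) ^+ n.+2]exprS; lra.
have -> : M = nrm (b 0%N) * L by rewrite mulrC divfK // gt_eqF.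
rewrite exprMn.
have hq : 0 <= nrm (b 0%N) * nrm (c 0%N) * q ^+ n.+1 by rewrite !mulr_ge0 ?nrm_ge0 ?exprn_ge0 // ltW.
have hl : L * \sum_(i < n.+1) (1 + L) ^+ (n - i) <= (1 + L) ^+ n.+1 by rewrite hg; lra.
have := ler_wpM2l hq hl; lra.
Qed.

(* No completeness of R[i] is needed: the products of the partial sums of [b] and
   [c] tend to 1, and those of [b] tend to [g z], which is nonzero. *)
Lemma exps_inv b g c : exps b g -> b 0%N != 0 -> (forall n, conv b c n = (n == 0%N)%:R) ->
  (forall z, complex.Re z < 0 -> g z != 0) -> exps c (fun z => (g z)^-1).
Proof.
move=> hb b0 hc g0; have [M [p [M0 p0 hM]]] := exps_bound hb.
have [s s0 hs] := conv_inv_bound M0 p0 hM b0 hc.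
case: hb => r r0 hb.
exists (Num.min r (1 / 8 / (p + s))).
  by rewrite !lt_min r0 /=; apply: divr_gt0; [lra|exact: addr_gt0].
move=> z z0; rewrite !lt_min => /andP[zr zq].
have hzq : nrm z * (p + s) < 1 / 8 by rewrite -ltr_pdivlMr // addr_gt0.
have nz := nrm_ge0 z.
have aux (t : R) (L : R) x i : 0 <= L -> 0 < t -> t <= p + s -> nrm x <= L * t ^+ i ->
    nrm (x * z ^+ i) <= L * (nrm z * (p + s)) ^+ i.
  move=> L0 t0 tpq hx; rewrite nrmM nrmX exprMn [_ ^+ i * (p + s) ^+ i]mulrC mulrA.
  apply: ler_wpM2r; first by rewrite exprn_ge0.
  apply: le_trans hx _; apply: ler_wpM2l; first by [].
  by apply: lerXn2r => //; rewrite nnegrE; lra.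
have hprod : ccvg (fun K => psum b z K * psum c z K) 1.
  have h : ccvg (fun K => psum b z K * psum c z K - 1) 0.
    apply/ccvg_shift.
    have hk K : \sum_(k < K.+1) conv (fun i => b i * z ^+ i) (fun i => c i * z ^+ i) k = 1.
      rewrite (eq_bigr (fun k : 'I_K.+1 => (k == 0%N :> nat)%:R)) ?big_ord_recl /= ?big1 ?addr0 //.
      move=> k _; transitivity (conv b c k * z ^+ k); last first.
        by rewrite hc; case: (k == 0 :> nat)%N /eqP => [->|]; rewrite ?mulr1 ?mul0r.
      rewrite /conv mulr_suml; apply: eq_bigr => i _.
      by rewrite mulrACA -exprD subnKC // -ltnS.
    apply: (@ccvg_geom _ _ (M * nrm (c 0%N) / 2)) => K; rewrite subr0 -(hk K) nrmBC.
    have -> : M * nrm (c 0%N) / 2 * (1 / 2) ^+ K = M * nrm (c 0%N) * (1 / 2) ^+ K.+1.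
      by rewrite exprS; field.
    apply: (@cauchy_product_bound _ _ _ _ (nrm z * (p + s))).
    - by rewrite mulr_ge0 ?(ltW hzq) // addr_ge0 ?ltW.
    - exact: ltW.
    - exact: nrm_ge0.
    - by move=> i; apply: aux (hM i) => //; lra.
    - by move=> i; apply: aux (hs i) => //; rewrite ?nrm_ge0 //; lra.
  have := ccvgD h (ccvg_cst 1); rewrite add0r.
  by apply: eq_ccvg => n; rewrite subrK.
have hbz := hb _ z0 zr; have gz := g0 _ z0.
have h1 := ccvgM hprod (ccvgV gz hbz); rewrite mul1r in h1.
apply/ccvg_nrmP => e e0; have [N1 h2] := (ccvg_nrmP _ _).1 h1 _ e0.
have gz' : 0 < nrm (g z) by rewrite nrm_gt0.
(* From [N2] on the partial sums of [b] are closer to [g z] than 0 is, hence nonzero, and can be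
   cancelled. *)
have [N2 h3] := (ccvg_nrmP _ _).1 hbz _ gz'.
exists (maxn N1 N2) => n; rewrite geq_max => /andP[n1 n2].
have := h2 n n1; rewrite mulrAC mulfV ?mul1r //.
by apply: contraTneq (h3 n n2) => ->; rewrite add0r nrmN ltxx.
Qed.

End PowerSeries.

(** * The complex exponential and its expansion at 0 *)

Section Exponential.
Variable R : realType.
Local Notation C := R[i].
Implicit Types (u v a b c : nat -> C) (f g : C -> C) (z w : C).
Lemma cexpE (x y : R) : cexp (x +i* y) = (expR x * cos y) +i* (expR x * sin y).
Proof.
by rewrite /cexp -complexiE /real_complex_def; simpc.
Qed.

Lemma cexpD z w : cexp (z + w) = cexp z * cexp w.
Proof.
case: z w => a b [c d].
have -> : a +i* b + (c +i* d) = (a + c) +i* (b + d) :> C by simpc.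
rewrite !cexpE; simpc.
by rewrite expRD cosD sinD; congr (_ +i* _); ring.
Qed.

Lemma cexp0 : cexp 0 = 1 :> C.
Proof. by rewrite -[X in cexp X]/(0 +i* 0 : C) cexpE expR0 cos0 sin0 mulr0 mulr1. Qed.

Lemma nrm_cexp z : nrm (cexp z) = expR (complex.Re z).
Proof.
case: z => x y; rewrite cexpE /nrm normc_def /= !exprMn -mulrDr cos2Dsin2 mulr1.
by rewrite sqrtr_sqr ger0_norm // expR_ge0.
Qed.

Lemma ccvg_of_real (x : nat -> R) (l : R) : x n @[n --> \oo] --> l ->
  ccvg (fun n => (x n)%:C) l%:C.
Proof.
move=> /cvgrPdist_lt h; apply/ccvg_nrmP => e /h [N _ hN]; exists N => n /hN /=.
by rewrite -rmorphB nrm_real distrC.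
Qed.

Lemma nrm_fact n : nrm (n`!%:R^-1 : C) <= 1.
Proof.
rewrite -(rmorph_nat (real_complex R)) -fmorphV nrm_real ger0_norm ?invr_ge0 //.
by rewrite invf_le1 ?ltr0n ?fact_gt0 // ler1n fact_gt0.
Qed.

Lemma nrm_complex_ge_Re z : `|complex.Re z| <= nrm z.
Proof. by rewrite -lecR -nrmE normc_ge_Re. Qed.

Lemma nrm_complex_ge_Im z : `|complex.Im z| <= nrm z.
Proof.
case: z => x y /=; rewrite /nrm normc_def /= -sqrtr_sqr.
by apply: ler_wsqrtr; rewrite lerDr sqr_ge0.
Qed.

Lemma nrm_i : nrm (0 +i* 1 : C) = 1.
Proof. by rewrite /nrm normc_def /= expr0n expr1n add0r sqrtr1. Qed.

Lemma half_pred_odd n : odd n -> n.-1./2 = n./2.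
Proof. by case: n => //= n /negbTE ho; rewrite uphalf_half ho. Qed.

(** The real series of e^x is multiplied by that of e^(iy), assembled from cosine and sine; the
    binomial theorem recognises the Cauchy product. The bound 1/8 is the ratio allowed in
    [ccvg_conv], and a neighbourhood of 0 is all that [exps] needs. *)
Lemma cexp_series z : nrm z <= 1 / 8 -> ccvg (fun K => \sum_(n < K) z ^+ n / n`!%:R) (cexp z).
Proof.
case: z => x y hz.
have hx : ccvg (fun K => \sum_(n < K) x%:C ^+ n / n`!%:R) (expR x)%:C.
  apply: eq_ccvg (ccvg_of_real (is_cvg_series_exp_coeff x)) => K.
  rewrite /series /= big_mkord rmorph_sum; apply: eq_bigr => n _.
  by rewrite fmorph_div rmorphXn rmorph_nat.
have hy : ccvg (fun K => \sum_(n < K) (0 +i* y) ^+ n / n`!%:R) (cos y +i* sin y).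
  have hc : ccvg (fun K => (series (cos_coeff y) K)%:C) (cos y)%:C.
    by rewrite cos.unlock; apply: ccvg_of_real; exact: is_cvg_series_cos_coeff.
  have hs : ccvg (fun K => (series (sin_coeff y) K)%:C) (sin y)%:C.
    by rewrite sin.unlock; apply: ccvg_of_real; exact: is_cvg_series_sin_coeff.
  have := ccvgD hc (ccvgM (ccvg_cst (0 +i* 1)) hs).
  have -> : (cos y)%:C + (0 +i* 1) * (sin y)%:C = cos y +i* sin y :> C.
    by rewrite /real_complex_def; simpc.
  apply: eq_ccvg => K; rewrite /series /= !big_mkord !rmorph_sum mulr_sumr -big_split /=.
  apply: eq_bigr => n _.
  have -> : 0 +i* y = (0 +i* 1) * y%:C :> C by rewrite /real_complex_def; simpc.
  rewrite exprMn -rmorphXn.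
  (* Powers of i split by parity in the shape of [cos_coeff] and [sin_coeff]; for odd n, [n.-1./2]
     equals [n./2]. *)
  have hi : (0 +i* 1) ^+ n = ((~~ odd n)%:R * (-1) ^+ n./2)%:C +
      (0 +i* 1) * ((odd n)%:R * (-1) ^+ n.-1./2)%:C :> C.
    have hsq k : (0 +i* 1) ^+ k.*2 = ((-1) ^+ k)%:C :> C.
      rewrite -mul2n exprM rmorphXn; congr (_ ^+ _).
      by rewrite expr2 /real_complex_def; simpc.
    rewrite -{1}(odd_double_half n) exprD hsq.
    case: (boolP (odd n)) => /= ho.
      rewrite half_pred_odd //.
      by rewrite mul0r mul1r add0r expr1.
    by rewrite expr0 !mul1r mul0r mulr0 addr0.
  rewrite hi -(rmorph_nat (real_complex R)) -fmorphV.
  rewrite !rmorphM !rmorphXn !rmorph_nat !rmorphN1 fmorphV !rmorph_nat; ring.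
have -> : cexp (x +i* y) = (expR x)%:C * (cos y +i* sin y).
  by rewrite cexpE /real_complex_def; simpc.
have h := @ccvg_conv _ (fun n => x%:C ^+ n / n`!%:R) (fun n => (0 +i* y) ^+ n / n`!%:R)
  1 1 (nrm (x +i* y)) _ _ _ ler01 ler01 _ _ hx hy.
apply: (eq_ccvg _ (h _ _ _)).
- move=> K; apply: eq_bigr => n _; rewrite /conv.
  have -> : x +i* y = x%:C + (0 +i* y) by rewrite /real_complex_def; simpc.
  rewrite addrC exprDn mulr_suml; apply: eq_bigr => i _.
  have hi : (i <= n)%N by rewrite -ltnS.
  rewrite -(bin_fact hi) !natrM -mulr_natr.
  have hn k : (k`!%:R : C) != 0 by rewrite pnatr_eq0 -lt0n fact_gt0.
  have hb : ('C(n, i)%:R : C) != 0 by rewrite pnatr_eq0 -lt0n bin_gt0.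
  by field; rewrite ?hn ?hb.
- by rewrite nrm_ge0 hz.
- move=> i; rewrite nrmM nrmX mul1r; apply: le_trans (_ : _ * 1 <= _).
    by apply: ler_wpM2l; rewrite ?nrm_fact ?exprn_ge0 ?nrm_ge0.
  rewrite mulr1 nrm_real; apply: lerXn2r; rewrite ?nnegrE ?nrm_ge0 //.
  exact: (nrm_complex_ge_Re (x +i* y)).
- move=> i; rewrite nrmM nrmX mul1r; apply: le_trans (_ : _ * 1 <= _).
    by apply: ler_wpM2l; rewrite ?nrm_fact ?exprn_ge0 ?nrm_ge0.
  rewrite mulr1; apply: lerXn2r; rewrite ?nnegrE ?nrm_ge0 //.
  have -> : 0 +i* y = (0 +i* 1) * y%:C :> C by rewrite /real_complex_def; simpc.
  by rewrite nrmM nrm_i mul1r nrm_real; exact: (nrm_complex_ge_Im (x +i* y)).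
Qed.

Lemma exps_cexp (k : C) : exps (fun n => k ^+ n / n`!%:R) (fun z => cexp (k * z)).
Proof.
have [->|k0] := eqVneq k 0.
  apply: eq_exps (exps_const 1) => [n|z _]; last by rewrite mul0r cexp0.
  by rewrite expr0n; case: n => [|n]; rewrite /= ?mul0r // divr1.
have nk : 0 < nrm k by rewrite nrm_gt0.
exists (1 / 8 / nrm k); first by apply: divr_gt0 => //; lra.
move=> z _; rewrite ltr_pdivlMr // => zr.
apply: eq_ccvg (cexp_series (_ : nrm (k * z) <= _)); last by rewrite nrmM mulrC ltW.
by move=> n; apply: eq_bigr => i _; rewrite exprMn mulrAC.
Qed.

End Exponential.

(** * Truncated sums over increasing indices *)

Section WordSums.
Variables (T : comPzRingType) (E : nat -> letter -> T).
Implicit Types (w u v : word) (m s : seq nat) (L j : nat).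

Definition all0 s := all (fun n => n == 0%N) s.

(* Sum over increasing indices in [j, j + L): [m] lists the exponents of x_j,
   x_(j+1), ..., and the index j is either taken by the first letter of [w] or
   skipped. *)
Fixpoint wsum L j w m : T :=
  if L is L'.+1 then
    (if w is l :: w' then (l.1 == head 0%N m)%:R * E j l * wsum L' j.+1 w' (behead m) else 0) +
    (head 0%N m == 0%N)%:R * wsum L' j.+1 w (behead m)
  else (nilp w && all0 m)%:R.

Lemma all0_head m : all0 m = (head 0%N m == 0%N) && all0 (behead m).
Proof. by case: m. Qed.

Lemma wsum_nil L j m : wsum L j [::] m = (all0 m)%:R.
Proof.
elim: L j m => [|L IH] j m //=.
by rewrite add0r IH -natrM mulnb -all0_head.
Qed.

Lemma wsum_eq0 L j w m : all (fun l : letter => l.1 == 0%N) w -> ~~ all0 m -> wsum L j w m = 0.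
Proof.
elim: L j w m => [|L IH] j w m hw hm /=; first by rewrite (negbTE hm) andbF.
rewrite all0_head negb_and in hm.
have h0 w' : all (fun l : letter => l.1 == 0%N) w' ->
    (head 0%N m == 0%N)%:R * wsum L j.+1 w' (behead m) = 0.
  by move=> hw'; case: eqP hm => /= [_ hm|_ _]; rewrite ?mul0r // IH ?mulr0.
case: w hw => [|l w] /=; first by move=> _; rewrite h0 // addr0.
move=> /andP[/eqP hl hw]; rewrite h0 /= ?hl ?eqxx // addr0 eq_sym mulrAC.
by rewrite h0 // mul0r.
Qed.

Lemma wsum_nil_eq0 L j w : ~~ all (fun l : letter => l.1 == 0%N) w -> wsum L j w [::] = 0.
Proof.
elim: L j w => [|L IH] j [|l w] //= hw; rewrite (IH _ (l :: w)) // mulr0 addr0.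
by case: eqP hw => /= [_ hw|_ _]; rewrite ?mul0r // IH ?mulr0.
Qed.

Lemma canon_behead m : canon m -> canon (behead m).
Proof. by case: m => [|a [|b m]]. Qed.

Lemma canon_all0 m : canon m -> all0 m = nilp m.
Proof.
case/lastP: m => // m a; rewrite /canon last_rcons /all0 all_rcons => /negbTE ->.
by case: m.
Qed.

(** A canonical nonempty [m] ends in a nonzero exponent, which [v] cannot supply, so no letter of
    [v] takes one of the first [size m] indices. Beyond them no exponent is left for the last letter
    of [u], which is positive. *)
Lemma wsum_cat L j u v m : canon m -> Gword u -> all (fun l : letter => l.1 == 0%N) v ->
  wsum (size m + L) j (u ++ v) m = wsum (size m) j u m * wsum L (j + size m) v [::].
Proof.
move=> cm hu hv; elim: m j u cm hu => [|a m IH] j u cm hu.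
  rewrite /= add0n addn0; case: u hu => [|l u] hu; first by rewrite mul1r.
  rewrite mul0r wsum_nil_eq0 // all_cat negb_and -has_predC; apply/orP; left.
  apply/hasP; exists (last (0, 0)%N (l :: u)); first exact: (mem_last l u).
  by rewrite /= -lt0n.
have cm' : canon m := canon_behead cm.
case: u hu => [|l u] hu.
  have -> : wsum (size (a :: m)) j [::] (a :: m) = 0 by rewrite wsum_nil canon_all0.
  by rewrite mul0r wsum_eq0 // canon_all0.
have hu' : Gword u by case: u hu.
rewrite [size _]/= addSn /= -cat_cons !IH // addSnnS; ring.
Qed.

Lemma wsum_geom L j w m (q : nat -> T) :
  (forall a b, q (a + b)%N = q a * q b) -> q 0%N = 1 ->
  (forall i (l : letter), E i.+1 l = q l.2 * E i l) ->
  wsum L j.+1 w m = q (sumn (map snd w)) * wsum L j w m.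
Proof.
move=> qD q0 hq; elim: L j w m => [|L IH] j w m /=.
  by case: w => [|l w]; rewrite /= ?q0 ?mul1r // mulr0.
by case: w => [|l w] /=; rewrite !IH /= ?hq ?qD ?q0; ring.
Qed.

End WordSums.

Lemma wsum_shift (T : comPzRingType) (E : nat -> letter -> T) L j w m :
  wsum E L j.+1 w m = wsum (fun i => E i.+1) L j w m.
Proof. by elim: L j w m => [|L IH] j w m //=; rewrite IH; case: w => // l w; rewrite IH. Qed.

Lemma mnorm_cons_eq a s m :
  (mnorm (a :: s) == mnorm m) = (a == head 0%N m) && (mnorm s == mnorm (behead m)).
Proof.
case: m => [|b m] /=.
  by case: (a == 0%N) => //=; case: (mnorm s).
case: (eqVneq a 0%N) (eqVneq b 0%N) => [->|a0] [->|b0] /=.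
- by case: (mnorm s) (mnorm m) => [|? ?] [|? ?]; rewrite ?eqseq_cons ?eqxx.
- by case: (mnorm s) => [|? ?]; rewrite ?eqseq_cons // eq_sym (negbTE b0).
- by case: (mnorm m) => [|? ?]; rewrite ?eqseq_cons // (negbTE a0).
- by rewrite eqseq_cons.
Qed.

Lemma mnorm_nil_eq m : ([::] == mnorm m) = all0 m.
Proof.
by elim: m => [|a m IH] //=; rewrite -IH; case: (a == 0%N) => //=; case: (mnorm m).
Qed.

Lemma mnorm_id m : canon m -> mnorm m = m.
Proof.
elim: m => [|a m IH] // cm; rewrite /= IH ?(canon_behead cm) //.
by case: m cm {IH} => [|b m]; rewrite /canon /= ?andbT ?andbF // => /negbTE ->.
Qed.

Lemma expo_mapS I w : all (ltn 0) I ->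
  expo (map succn I) w = if nilp (zip I w) then [::] else 0%N :: expo I w.
Proof.
elim: I w => [|[|i] I IH] [|l w] //= hI; move: (IH w hI); rewrite /expo /= => ->.
by case: (zip I w) => //=; rewrite /unitexp /=; case: (rcons _ _).
Qed.

Lemma mnorm_expo_mapS I w : all (ltn 0) I ->
  mnorm (expo (map succn I) w) = mnorm (0%N :: expo I w).
Proof.
by move=> hI; rewrite expo_mapS //; case: ifP => // /nilP h; rewrite /expo h.
Qed.

Lemma mnorm_expo_cons I l w : all (ltn 0) I ->
  mnorm (expo (1%N :: map succn I) (l :: w)) = mnorm (l.1 :: expo I w).
Proof.
move=> hI; have -> : expo (1%N :: map succn I) (l :: w) = addl [:: l.1] (expo (map succn I) w) by [].
rewrite expo_mapS //=.
by case: ifP => [/nilP h|]; rewrite ?addn0 // /expo h.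
Qed.

Lemma incs_map (f : nat -> nat) s k : incs (map f s) k = map (map f) (incs s k).
Proof.
elim: s k => [|x s IH] [|k] //=; rewrite !IH map_cat -!map_comp.
by congr (_ ++ _); apply: eq_map.
Qed.

Lemma incs_all (P : pred nat) s k : all P s -> all (all P) (incs s k).
Proof.
elim: s k => [|x s IH] [|k] //= /andP[hx hs]; rewrite all_cat IH // andbT.
by rewrite all_map; apply: sub_all (IH k hs) => I hI /=; rewrite hx.
Qed.

Lemma zip_mapl (S T U : Type) (f : S -> T) (s : seq S) (t : seq U) :
  zip (map f s) t = map (fun p => (f p.1, p.2)) (zip s t).
Proof. by elim: s t => [|x s IH] [|y t] //=; rewrite IH. Qed.

(** [incs] branches on whether the first index is taken, just as [wsum] does; the remaining indices
    are renumbered from 1 while [E] is shifted. *)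
Lemma wsumE (T : comPzRingType) (E : nat -> letter -> T) L w m :
  \sum_(I <- incs (iota 1 L) (size w))
    (if mnorm (expo I w) == mnorm m then \prod_(p <- zip I w) E p.1 p.2 else 0) =
  wsum E L 1 w m.
Proof.
elim: L E w m => [|L IH] E [|l w] m.
- by rewrite big_seq1 /= mnorm_nil_eq big_nil; case: all0.
- by rewrite big_nil.
- by rewrite wsum_nil big_seq1 /= mnorm_nil_eq big_nil; case: all0.
rewrite [iota _ _]/= [iota 2 L](iotaDl 1 1) [incs _ _]/= big_cat /= !(wsum_shift _ _ 1) -!IH.
have pos k : all (all (ltn 0)) (incs (iota 1 L) k).
  by apply: incs_all; apply/allP => i; rewrite mem_iota => /andP[].
rewrite !incs_map !big_map; congr (_ + _).
  rewrite mulr_sumr; apply: eq_big_seq => I /(allP (pos _)) hI.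
  rewrite mnorm_expo_cons // mnorm_cons_eq; case: eqP => _ /=; last by rewrite !mul0r.
  rewrite mul1r; case: ifP => _; last by rewrite mulr0.
  by rewrite big_cons zip_mapl big_map.
rewrite mulr_sumr; apply: eq_big_seq => I /(allP (pos _)) hI.
rewrite mnorm_expo_mapS // mnorm_cons_eq eq_sym; case: eqP => _; last by rewrite mul0r.
rewrite mul1r andTb; case: ifP => _ //.
by rewrite -[X in \prod_(p <- X) E p.1 p.2]/(zip (map succn I) (l :: w)) zip_mapl big_map.
Qed.

Lemma wsum_mnorm (T : comPzRingType) (E : nat -> letter -> T) L w m :
  wsum E L 1 w (mnorm m) = wsum E L 1 w m.
Proof. by rewrite -!wsumE mnorm_id // canon_mnorm. Qed.

Lemma mkmono_eq s (m : mono) : (mkmono s == m) = (mnorm s == mnorm (val m)).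
Proof. by rewrite -val_eqE /= (mnorm_id (valP m)). Qed.

(** * Factorisations of a monomial and the quasi-shuffle product *)

Lemma below_cons a m :
  below (a :: m) = flatten [seq [seq b :: r | r <- below m] | b <- iota 0 a.+1].
Proof. by []. Qed.

Lemma sum_below (T : pzSemiRingType) (F : nat -> seq nat -> nat -> seq nat -> T) m :
  \sum_(s <- below m) F (head 0%N s) (behead s) (head 0%N (subl m s)) (behead (subl m s)) =
  \sum_(b < (head 0%N m).+1) \sum_(r <- below (behead m)) F b r (head 0%N m - b)%N (subl (behead m) r).
Proof.
case: m => [|a m]; first by rewrite big_ord1 !big_seq1.
rewrite below_cons big_flatten big_map -val_enum_ord big_map big_enum /=.
by apply: eq_bigr => b _; rewrite big_map.
Qed.

Lemma sum_below0 m : (\sum_(s <- below m) (all0 s && all0 (subl m s)) = all0 m)%N.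
Proof.
elim: m => [|a m IH]; first by rewrite big_seq1.
rewrite below_cons big_flatten big_map big_cons big_map /= subn0.
rewrite [X in (_ + X)%N]big1_seq ?addn0; last first.
  move=> b /andP[_]; rewrite mem_iota => /andP[b1 _]; rewrite big_map big1 // => s _ /=.
  by case: b b1.
case: (a == 0%N) => /=; last by rewrite big1 // => s _; rewrite andbF.
by rewrite IH.
Qed.

(** At index j there are four possibilities: only [a] uses it, only [b], both, or neither. The first
    three are the three terms of the quasi-shuffle recursion, with [hE] merging the letters when
    both use j; the last leaves both words for index j + 1. *)
Lemma wsum_mul (T : comPzRingType) (E : nat -> letter -> T) L j a b m :
  (forall i (x y : letter), E i (x.1 + y.1, x.2 + y.2)%N = E i x * E i y) ->
  \sum_(s <- below m) wsum E L j a s * wsum E L j b (subl m s) =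
  \sum_(w <- qsh a b) wsum E L j w m.
Proof.
move=> hE; elim: L j a b m => [|L IH] j a b m.
  case: a b => [|x a] [|y b] /=; rewrite ?big_seq1.
  - by rewrite -sum_below0 natr_sum; apply: eq_bigr => s _; rewrite -natrM mulnb.
  - by rewrite big1 // => s _; rewrite mulr0.
  - by rewrite big1 // => s _; rewrite mul0r.
  - rewrite !big_cat /= !big_map big1 ?big1 ?addr0 // => s _; rewrite ?mul0r //.
(* One unfolding of [wsum], with the exponent of x_j and the rest of the monomial as separate
   arguments, the shape that [sum_below] expects. *)
pose A w b' r := (if w is l :: w' then (l.1 == b')%:R * E j l * wsum E L j.+1 w' r else 0) +
  (b' == 0%N)%:R * wsum E L j.+1 w r.
have key : \sum_(s <- below m) wsum E L.+1 j a s * wsum E L.+1 j b (subl m s) =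
    \sum_(c < (head 0%N m).+1) \sum_(r <- below (behead m))
      A a c r * A b (head 0%N m - c)%N (subl (behead m) r).
  exact: (sum_below (fun c r c' r' => A a c r * A b c' r')).
rewrite key; set h := head 0%N m; set m' := behead m.
(* Exponents x and y taken at index j fit exactly one splitting of h, and only when x + y = h. *)
have pick (x y : nat) : (\sum_(c < h.+1) ((x == c :> nat) && (y == h - c)%N) = (x + y == h))%N.
  have [hx|hx] := leqP x h.
    rewrite (bigD1 (Ordinal (hx : (x < h.+1)%N))) //= eqxx /= big1 ?addn0.
      by congr nat_of_bool; apply/eqP/eqP; lia.
    by move=> c /eqP hc; case: eqP => // e; case: hc; apply: val_inj.
  rewrite big1 => [|c _]; first by case: eqP => // e; lia.
  by case: eqP => // e; have := ltn_ord c; lia.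
have pickR (x y : nat) (k : T) :
    \sum_(c < h.+1) (x == c :> nat)%:R * (y == h - c)%N%:R * k = (x + y == h)%N%:R * k.
  by rewrite -mulr_suml -pick natr_sum; congr (_ * _); apply: eq_bigr => c _; rewrite -mulnb natrM.
have expand (a' b' : word) (x y : nat) (k k' : T) :
  \sum_(c < h.+1) \sum_(r <- below m') ((x == c :> nat)%:R * k * wsum E L j.+1 a' r) *
     ((y == h - c)%N%:R * k' * wsum E L j.+1 b' (subl m' r)) =
  (x + y == h)%N%:R * (k * k') * \sum_(w <- qsh a' b') wsum E L j.+1 w m'.
  rewrite -IH -mulrA -pickR; apply: eq_bigr => c _; rewrite mulrA mulr_sumr.
  by apply: eq_bigr => r _; ring.
have expand0 (a' b' : word) :
  \sum_(c < h.+1) \sum_(r <- below m') ((c == 0%N :> nat)%:R * wsum E L j.+1 a' r) *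
     ((h - c == 0)%N%:R * wsum E L j.+1 b' (subl m' r)) =
  (h == 0%N)%:R * \sum_(w <- qsh a' b') wsum E L j.+1 w m'.
  have := expand a' b' 0%N 0%N 1 1; rewrite !mulr1 eq_sym => <-.
  by apply: eq_bigr => c _; apply: eq_bigr => r _; rewrite !mulr1 ![0%N == _]eq_sym.
have expandl (a' b' : word) (x : nat) (k : T) :
  \sum_(c < h.+1) \sum_(r <- below m') ((x == c :> nat)%:R * k * wsum E L j.+1 a' r) *
     ((h - c == 0)%N%:R * wsum E L j.+1 b' (subl m' r)) =
  (x == h)%:R * k * \sum_(w <- qsh a' b') wsum E L j.+1 w m'.
  have := expand a' b' x 0%N k 1; rewrite !mulr1 addn0 => <-.
  by apply: eq_bigr => c _; apply: eq_bigr => r _; rewrite !mulr1 ![0%N == _]eq_sym.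
have expandr (a' b' : word) (y : nat) (k : T) :
  \sum_(c < h.+1) \sum_(r <- below m') ((c == 0%N :> nat)%:R * wsum E L j.+1 a' r) *
     ((y == h - c)%N%:R * k * wsum E L j.+1 b' (subl m' r)) =
  (y == h)%:R * k * \sum_(w <- qsh a' b') wsum E L j.+1 w m'.
  have := expand a' b' 0%N y 1 k; rewrite !mul1r => <-.
  by apply: eq_bigr => c _; apply: eq_bigr => r _; rewrite !mulr1 ![0%N == _]eq_sym.
have cons_sum l (s : seq word) : \sum_(w <- map (cons l) s) wsum E L.+1 j w m =
    (l.1 == h)%:R * E j l * \sum_(w <- s) wsum E L j.+1 w m' +
    (h == 0%N)%:R * \sum_(w <- map (cons l) s) wsum E L j.+1 w m'.
  by rewrite !big_map !mulr_sumr -big_split.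
case: a b {key IH} => [|x a] [|y b]; rewrite /A.
- rewrite (eq_bigr (fun c : 'I_h.+1 => \sum_(r <- below m') ((c == 0%N :> nat)%:R * wsum E L j.+1 [::] r) *
     ((h - c == 0)%N%:R * wsum E L j.+1 [::] (subl m' r)))); last first.
    by move=> c _; apply: eq_bigr => r _; rewrite !add0r.
  by rewrite expand0 !big_seq1 /= add0r.
- rewrite [RHS](_ : _ = \sum_(w <- map (cons y) [:: b]) wsum E L.+1 j w m) //.
  rewrite cons_sum -[map _ _]/(qsh [::] (y :: b)) -[[:: b]]/(qsh [::] b) -expand0 -expandr -big_split.
  apply: eq_bigr => c _; rewrite -big_split; apply: eq_bigr => r _ /=; ring.
- rewrite [RHS](_ : _ = \sum_(w <- map (cons x) [:: a]) wsum E L.+1 j w m) //.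
  have ha : [:: a] = qsh a [::] by case: (a).
  rewrite cons_sum -[map _ _]/(qsh (x :: a) [::]) ha -expand0 -expandl -big_split.
  apply: eq_bigr => c _; rewrite -big_split; apply: eq_bigr => r _ /=; ring.
have -> : qsh (x :: a) (y :: b) = map (cons x) (qsh a (y :: b)) ++ map (cons y) (qsh (x :: a) b)
                   ++ map (cons (x.1 + y.1, x.2 + y.2)%N) (qsh a b) by [].
rewrite !big_cat !cons_sum /= hE.
transitivity ((x.1 == h)%:R * E j x * \sum_(w <- qsh a (y :: b)) wsum E L j.+1 w m'
  + (y.1 == h)%:R * E j y * \sum_(w <- qsh (x :: a) b) wsum E L j.+1 w m'
  + (x.1 + y.1 == h)%N%:R * (E j x * E j y) * \sum_(w <- qsh a b) wsum E L j.+1 w m'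
  + (h == 0%N)%:R * \sum_(w <- qsh (x :: a) (y :: b)) wsum E L j.+1 w m').
  rewrite -expand0 -expand -expandl -expandr -!big_split.
  apply: eq_bigr => c _; rewrite -!big_split; apply: eq_bigr => r _ /=; ring.
rewrite [qsh (x :: a) (y :: b)](_ : _ = map (cons x) (qsh a (y :: b)) ++ map (cons y) (qsh (x :: a) b)
                   ++ map (cons (x.1 + y.1, x.2 + y.2)%N) (qsh a b)) // !big_cat /=; ring.
Qed.

(** * The divergent tail *)

(** Each coefficient of the inverse depends on all earlier ones, so the recursion builds the list of
    values found so far and reads off its last entry. *)
Lemma conv_inverse (F : fieldType) (b : nat -> F) : b 0%N != 0 ->
  exists c : nat -> F, forall n, conv b c n = (n == 0%N)%:R.
Proof.
move=> b0.
pose next (s : seq F) := - (b 0%N)^-1 * \sum_(i < size s) b i.+1 * s`_(size s - i.+1).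
pose fix vals n := if n is n'.+1 then rcons (vals n') (next (vals n')) else [:: (b 0%N)^-1].
have size_vals n : size (vals n) = n.+1 by elim: n => //= n IH; rewrite size_rcons IH.
have nth_vals n i : (i <= n)%N -> (vals n)`_i = (vals i)`_i.
  elim: n => [|n IH]; first by rewrite leqn0 => /eqP ->.
  rewrite leq_eqVlt => /orP[/eqP -> //|]; rewrite ltnS => hi.
  by rewrite [vals n.+1]/= nth_rcons size_vals ltnS hi IH.
exists (fun n => (vals n)`_n) => -[|n]; rewrite /conv.
  by rewrite big_ord1 /= mulfV.
rewrite big_ord_recl subn0 /= nth_rcons size_vals ltnn eqxx /next size_vals.
rewrite mulNr mulrN mulVKf // addrC; apply/eqP; rewrite subr_eq0; apply/eqP.
by apply: eq_bigr => i _; rewrite /bump /= add1n subSS [in RHS]nth_vals ?leq_subr.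
Qed.

Section TailSums.
Variable R : realType.
Local Notation C := R[i].
Implicit Types (a b c : nat -> C) (f g : C -> C) (z : C) (t : R) (v w : word).

(** The limit is the fixed point d = l + q d: the distance to d shrinks by |q| at each step, up to
    the vanishing error |c_n - l|. *)
Lemma ccvg_linear_rec (p c : nat -> C) (q l : C) : nrm q < 1 -> ccvg c l ->
  (forall n, p n.+1 = c n + q * p n) -> ccvg p (l / (1 - q)).
Proof.
move=> q1 /ccvg_nrmP hc hp; set d := l / (1 - q).
have q10 : 1 - q != 0.
  by rewrite subr_eq0; apply: contraTneq q1 => <-; rewrite nrm_real normr1 ltxx.
have hd : d = l + q * d by rewrite /d; field.
have step n : nrm (p n.+1 - d) <= nrm (c n - l) + nrm q * nrm (p n - d).
  rewrite -nrmM hp {1}hd; have -> : c n + q * p n - (l + q * d) = c n - l + q * (p n - d) by ring.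
  exact: ler_nrmD.
apply/ccvg_nrmP => e e0.
(* Errors of this size accumulate to at most e/2, the fixed point of x -> e (1 - |q|)/2 + |q| x. *)
have he0 : 0 < e * (1 - nrm q) / 2 by rewrite divr_gt0 // mulr_gt0 // subr_gt0.
have [N hN] := hc _ he0.
have bound k : nrm (p (N + k)%N - d) <= e / 2 + nrm q ^+ k * nrm (p N - d).
  elim: k => [|k IH]; first by rewrite addn0 expr0; lra.
  rewrite addnS; apply: le_trans (step _) _.
  have h1 := hN (N + k)%N (leq_addr _ _).
  have h2 := ler_wpM2l (nrm_ge0 q) IH.
  rewrite exprS; lra.
have : nrm q ^+ k @[k --> \oo] --> (0 : R) by apply: cvg_expr; rewrite ger0_norm ?nrm_ge0.
have nd := nrm_ge0 (p N - d).
move=> /cvgrPdist_lt /(_ (e / 2 / (nrm (p N - d) + 1))).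
have he : 0 < e / 2 / (nrm (p N - d) + 1) by apply: divr_gt0; lra.
move=> /(_ he) [K _ hK]; exists (N + K)%N => n hn.
rewrite -(subnKC (leq_trans (leq_addr K N) hn)); apply: le_lt_trans (bound _) _.
have /hK /= : (K <= n - N)%N by lia.
rewrite sub0r normrN ger0_norm ?exprn_ge0 ?nrm_ge0 //.
rewrite ltr_pdivlMr; last lra.
have := exprn_ge0 (n - N) (nrm_ge0 q); lra.
Qed.

Definition wexp t z (i : nat) (l : letter) : C := cexp ((i%:R + t%:C) * l.2%:R * z).

Lemma phi_partialE w m t z L : phi_partial w m t z L = wsum (wexp t z) L 1 w (val m).
Proof. by rewrite -wsumE; apply: eq_bigr => I _; rewrite mkmono_eq. Qed.

Definition wt w := sumn (map snd w).

Lemma wt_cons (l : letter) w : wt (l :: w) = (l.2 + wt w)%N.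
Proof. by []. Qed.

Lemma wexpS t z L j w m :
  wsum (wexp t z) L j.+1 w m = cexp ((wt w)%:R * z) * wsum (wexp t z) L j w m.
Proof.
apply: (@wsum_geom _ (wexp t z) L j w m (fun n => cexp (n%:R * z))) => [a b||i l].
- by rewrite natrD mulrDl cexpD.
- by rewrite mul0r cexp0.
- by rewrite /wexp -cexpD; congr cexp; rewrite -natr1; ring.
Qed.

(* With i_s = j + (s - 1) + d_1 + ... + d_s, the sum over the indices >= j of a
   word with all alpha_i = 0 factors into geometric series in the d_s; [tailsum]
   is what remains after removing e^((j + t) (wt v) z). *)
Fixpoint tailsum z v : C :=
  if v is l :: v' then cexp ((wt v')%:R * z) * tailsum z v' / (1 - cexp ((wt v)%:R * z)) else 1.

Lemma tailsum_cons z (l : letter) v :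
  tailsum z (l :: v) = cexp ((wt v)%:R * z) * tailsum z v / (1 - cexp ((wt (l :: v))%:R * z)).
Proof. by []. Qed.

Lemma nrm_cexp_lt1 (n : nat) z : (0 < n)%N -> complex.Re z < 0 -> nrm (cexp (n%:R * z)) < 1.
Proof.
move=> n0 z0; rewrite nrm_cexp -(rmorph_nat (real_complex R)).
have -> : complex.Re (n%:R%:C * z) = n%:R * complex.Re z.
  by case: z {z0} => x y; rewrite /real_complex_def; simpc.
have hn : 0 < n%:R :> R by rewrite ltr0n.
by rewrite -[X in _ < X]expR0 ltr_expR (pmulr_rlt0 _ hn).
Qed.

Lemma one_sub_cexp_neq0 (n : nat) z : (0 < n)%N -> complex.Re z < 0 -> 1 - cexp (n%:R * z) != 0.
Proof.
move=> n0 z0; rewrite subr_eq0; apply: contraTneq (nrm_cexp_lt1 n0 z0) => <-.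
by rewrite nrm_real normr1 ltxx.
Qed.

Lemma wt_gt0 (l : letter) v : Hword (l :: v) -> (0 < wt (l :: v))%N.
Proof. by rewrite /wt /= => /andP[h _]; rewrite addn_gt0 h. Qed.

(** Either the first letter takes index j, or it skips it and every index moves up by one, at the
    cost of a factor e^((wt) z) of modulus less than 1. This is a recursion of the form treated in
    [ccvg_linear_rec]. *)
Lemma tailsum_cvg t z j v : Hword v -> all (fun l : letter => l.1 == 0%N) v -> complex.Re z < 0 ->
  ccvg (fun L => wsum (wexp t z) L j v [::]) (cexp ((j%:R + t%:C) * (wt v)%:R * z) * tailsum z v).
Proof.
move=> hv hv0 z0; elim: v hv hv0 => [|l v IH] hv hv0.
  apply: eq_ccvg (ccvg_cst _) => L.
  by rewrite wsum_nil /= mulr0 mul0r cexp0 mulr1.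
move: (hv) (hv0) => /andP[_ hv'] /andP[/eqP l0 hv0'].
have h := IH hv' hv0'.
have := ccvg_linear_rec (p := fun L => wsum (wexp t z) L j (l :: v) [::]) (nrm_cexp_lt1 (wt_gt0 hv) z0)
  (ccvgM (ccvg_cst (wexp t z j l * cexp ((wt v)%:R * z))) h).
set d := (X in ccvg _ X); set d' := (X in _ -> ccvg _ X).
have -> : d = d'.
  have hne := one_sub_cexp_neq0 (wt_gt0 hv) z0.
  have e : cexp ((j%:R + t%:C) * (wt (l :: v))%:R * z) = wexp t z j l * cexp ((j%:R + t%:C) * (wt v)%:R * z).
    by rewrite wt_cons natrD mulrDr mulrDl cexpD.
  by rewrite /d /d' tailsum_cons e; field.
apply=> L; rewrite [wsum _ L.+1 _ _ _]/= l0 eqxx !mul1r !wexpS.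
by rewrite mulrA.
Qed.

Lemma conv_ratr (a b : nat -> rat) n :
  conv (fun n => ratr (a n)) (fun n => ratr (b n)) n = ratr (conv a b n) :> C.
Proof. by rewrite /conv rmorph_sum; apply: eq_bigr => i _; rewrite rmorphM. Qed.

Lemma ratr_exp_coeff (k n : nat) : ratr (k%:R ^+ n / n`!%:R) = k%:R ^+ n / n`!%:R :> C.
Proof. by rewrite fmorph_div rmorphXn !rmorph_nat. Qed.

(** These are Bernoulli numbers: z/(1 - e^(kz)) = - sum_n B_n k^(n-1) z^n / n!. The sequence [b]
    expands the reciprocal (1 - e^(kz))/z, whose constant term is -k. *)
Lemma exps_todd (k : nat) : (0 < k)%N ->
  exists c : nat -> rat, exps (fun n => ratr (c n)) (fun z : C => z / (1 - cexp (k%:R * z))).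
Proof.
move=> k0; pose b n : rat := - (k%:R ^+ n.+1 / n.+1`!%:R).
have b0 : b 0%N != 0 by rewrite /b expr1 divr1 oppr_eq0 pnatr_eq0 -lt0n.
have [c hc] := conv_inverse b0; exists c.
have hb : exps (fun n => ratr (b n)) (fun z : C => (1 - cexp (k%:R * z)) / z).
  have := exps_add (exps_const 1) (exps_scale (-1) (exps_cexp (k%:R : C))).
  move=> /exps_unshift h; apply: eq_exps (h _) => [n|z _|].
  - rewrite add0r mulN1r /b rmorphN; congr (- _).
    exact: (esym (ratr_exp_coeff _ _)).
  - by rewrite mulN1r.
  - by rewrite expr0 divr1 mulr1 subrr.
have h := exps_inv hb _ (fun n => etrans (conv_ratr b c n) (etrans (congr1 _ (hc n)) (ratr_nat _ _))).
apply: eq_exps (h _ _) => // [z z0||z z0].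
- by rewrite invf_div.
- by rewrite fmorph_eq0.
- rewrite mulf_neq0 ?invr_eq0 ?one_sub_cexp_neq0 //.
  by apply: contraTneq z0 => ->; rewrite ltxx.
Qed.

Lemma exps_tailsum v : Hword v -> exists h : nat -> rat,
  exps (fun n => ratr (h n)) (fun z : C => z ^+ size v * tailsum z v).
Proof.
elim: v => [|l v IH] hv.
  exists (fun n => (n == 0%N)%:R); apply: eq_exps (exps_const 1) => [n|z _].
    by rewrite ratr_nat; case: (n == 0%N).
  by rewrite mulr1.
have /andP[_ /IH [h hh]] := hv; have [c hc] := exps_todd (wt_gt0 hv).
exists (conv (conv (fun n => (wt v)%:R ^+ n / n`!%:R) h) c).
have := exps_mul (exps_mul (exps_cexp (wt v)%:R) hh) hc; apply: eq_exps => [n|z z0].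
  rewrite -conv_ratr; congr conv; apply/boolp.funext => k.
  by rewrite -conv_ratr; congr conv; apply/boolp.funext => i; rewrite ratr_exp_coeff.
have hne := one_sub_cexp_neq0 (wt_gt0 hv) z0.
by rewrite [size _]/= exprS tailsum_cons; field.
Qed.

End TailSums.

(** * Existence and uniqueness of the regularization *)

Section Regularization.
Variable R : realType.
Local Notation C := R[i].
Implicit Types (F G : fser) (z : C) (t : R) (v w : word) (m : mono).

Definition peval t (p : {poly rat}) : C := ((map_poly ratr p).[t])%:C.

Lemma peval0 t : peval t 0 = 0.
Proof. by rewrite /peval rmorph0 horner0. Qed.

Lemma pevalD t p q : peval t (p + q) = peval t p + peval t q.
Proof. by rewrite /peval rmorphD hornerD rmorphD. Qed.

Lemma pevalM t p q : peval t (p * q) = peval t p * peval t q.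
Proof. by rewrite /peval rmorphM hornerM rmorphM. Qed.

Lemma pevalC t c : peval t c%:P = ratr c.
Proof. by rewrite /peval map_polyC hornerC fmorph_rat. Qed.

Lemma pevalZ t c p : peval t (c *: p) = ratr c * peval t p.
Proof. by rewrite -mul_polyC pevalM pevalC. Qed.

Lemma pevalX t : peval t 'X = t%:C.
Proof. by rewrite /peval map_polyX hornerX. Qed.

Lemma pevalXn t p n : peval t (p ^+ n) = peval t p ^+ n.
Proof. by rewrite /peval !rmorphXn horner_exp rmorphXn. Qed.

Lemma peval_sum t (I : Type) (s : seq I) (P : pred I) (f : I -> {poly rat}) :
  peval t (\sum_(i <- s | P i) f i) = \sum_(i <- s | P i) peval t (f i).
Proof. exact: (big_morph _ (pevalD t) (peval0 t)). Qed.

Lemma peval_nat (k : nat) p : peval k%:R p = ratr p.[k%:R].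
Proof.
rewrite /peval -(ratr_nat R k) horner_map.
exact: fmorph_rat.
Qed.

(** The naturals are admissible values of t, and more of them are roots of p - q than its degree
    allows. *)
Lemma peval_inj p q : (forall t, 0 <= t -> peval t p = peval t q) -> p = q.
Proof.
move=> h; apply/eqP; rewrite -subr_eq0; apply: contraT => /max_poly_roots hr.
have := hr [seq k%:R | k <- iota 0 (size (p - q))].
rewrite size_map size_iota ltnn => -> //.
  apply/allP => x /mapP[k _ ->]; rewrite /root !hornerE subr_eq0.
  by rewrite -(fmorph_eq (ratr : {rmorphism rat -> C})) /= -!peval_nat h.
rewrite map_inj_uniq ?iota_uniq // => i j /eqP; rewrite eqr_nat => /eqP.
exact.
Qed.

Lemma Re_neq0 z : complex.Re z < 0 -> z != 0.
Proof. by apply: contraTneq => ->; rewrite ltxx. Qed.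

Lemma laurent_partialE F m N t z K : z != 0 ->
  laurent_partial F m N t z K =
  psum (fun i => peval t (F m (i%:Z - N%:Z))) z K * z ^- N.
Proof.
move=> z0; rewrite /psum mulr_suml; apply: eq_bigr => i _.
by rewrite -mulrA expfzDr // exprnN.
Qed.

Lemma ccvg_shiftn k (u : nat -> C) (l : C) : ccvg (fun n => u (k + n)%N) l -> ccvg u l.
Proof.
elim: k u => [|k IH] u h //; apply/ccvg_shift; apply: IH; apply: eq_ccvg h => n.
by rewrite addSn.
Qed.

Lemma word_split w : exists u v, [/\ w = u ++ v, Gword u & all (fun l : letter => l.1 == 0%N) v].
Proof.
elim/last_ind: w => [|w l [u [v [-> hu hv]]]]; first by exists [::], [::].
case: (posnP l.1) => hl.
  by exists u, (rcons v l); rewrite rcons_cat all_rcons hl eqxx.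
exists (rcons (u ++ v) l), [::]; rewrite cats0; split=> //.
by rewrite /Gword last_rcons hl orbT.
Qed.

Lemma phi_partial_cvg u v m t z : Gword u -> all (fun l : letter => l.1 == 0%N) v -> Hword v ->
  complex.Re z < 0 ->
  ccvg (phi_partial (u ++ v) m t z)
    (phi_partial u m t z (size (val m)) *
      (cexp (((size (val m)).+1%:R + t%:C) * (wt v)%:R * z) * tailsum z v)).
Proof.
move=> hu hv hhv z0; apply: (@ccvg_shiftn (size (val m))).
(* The factor from [u] no longer changes; the first index left for [v] is [size (val m)] + 1. *)
have := ccvgM (ccvg_cst (phi_partial u m t z (size (val m))))
  (tailsum_cvg t (size (val m)).+1 hhv hv z0).
by apply: eq_ccvg => L; rewrite !phi_partialE wsum_cat // (valP m).
Qed.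

(** The value of the coefficient series, with 0 as default where there is no limit; [phivalP] shows
    that the default does not intervene when Re z < 0. *)
Definition phival w m t z : C := xget 0 [set x | ccvg (phi_partial w m t z) x].

Lemma phivalP w m t z : Hword w -> complex.Re z < 0 ->
  ccvg (phi_partial w m t z) (phival w m t z).
Proof.
move=> hw z0; apply: (@xgetPex _ 0 [set x | ccvg (phi_partial w m t z) x]).
have [u [v [e hu hv]]] := word_split w; move: hw; rewrite e /Hword all_cat => /andP[_ hhv].
eexists; exact: phi_partial_cvg.
Qed.

Lemma is_regularizationP w F : Hword w -> is_regularization R w F <->
  forall m, exists N : nat, (forall n, n < - N%:Z -> F m n = 0) /\
    forall t, 0 <= t -> exps (fun i => peval t (F m (i%:Z - N%:Z))) (fun z => z ^+ N * phival w m t z).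
Proof.
move=> hw; split=> h m; have [N [hN h']] := h m; exists N; split=> // t t0.
  have [r [r0 hr]] := h' t t0; exists r => // z z0 zr.
  have [|x [hx hx']] := hr z z0; first by rewrite nrmE ltcR.
  have {}hx : ccvg (phi_partial w m t z) x by apply/ccvgE.
  have {}hx' : ccvg (laurent_partial F m N t z) x by apply/ccvgE.
  rewrite (ccvg_unique (phivalP m t hw z0) hx) mulrC.
  apply: eq_ccvg (ccvgM hx' (ccvg_cst (z ^+ N))) => K.
  by rewrite laurent_partialE ?Re_neq0 // mulfVK // expf_neq0 // Re_neq0.
have [r r0 hr] := h' t t0; exists r; split=> // z z0.
rewrite nrmE ltcR => zr; exists (phival w m t z); split; apply/ccvgE.
  exact: phivalP.
have := ccvgM (hr z z0 zr) (ccvg_cst (z ^- N)).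
rewrite mulrAC mulfV ?expf_neq0 ?Re_neq0 // mul1r; apply: eq_ccvg => K.
by rewrite laurent_partialE ?Re_neq0.
Qed.

(** A pole bound may be raised: the coefficients that enter are 0. Different expansions can thus be
    compared under one shift. *)
Lemma exps_lower F m t N K f : (forall n, n < - N%:Z -> F m n = 0) -> (N <= K)%N ->
  exps (fun i => peval t (F m (i%:Z - N%:Z))) (fun z => z ^+ N * f z) ->
  exps (fun i => peval t (F m (i%:Z - K%:Z))) (fun z => z ^+ K * f z).
Proof.
move=> hN /subnKC <-; elim: (K - N)%N => [|k IH] h; first by rewrite addn0.
apply: eq_exps (exps_delay (IH h)) => [[|i]|z _] /=.
- by rewrite hN ?peval0 //; lia.
- by congr (peval t (F m _)); lia.
- by rewrite addnS exprS mulrA.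
Qed.

Lemma regularization_unique w F G : Hword w ->
  is_regularization R w F -> is_regularization R w G -> F = G.
Proof.
move=> hw /(is_regularizationP _ hw) hF /(is_regularizationP _ hw) hG.
apply/boolp.funext => m; apply/boolp.funext => n.
have [N [N0 hN]] := hF m; have [M [M0 hM]] := hG m.
(* K exceeds both pole bounds, and the term |n| makes the shifted exponent n + K nonnegative. *)
pose K := (N + M + absz n)%N.
apply: peval_inj => t t0.
have hNK : (N <= K)%N by rewrite /K; lia.
have hMK : (M <= K)%N by rewrite /K; lia.
have := exps_unique (exps_lower N0 hNK (hN t t0)) (exps_lower M0 hMK (hM t t0)) (absz (n + K%:Z)).
by have -> : (absz (n + K%:Z))%:Z - K%:Z = n by lia.
Qed.

Lemma incs_size s k I : I \in incs s k -> size I = k.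
Proof.
elim: s k I => [|x s IH] [|k] I //=; rewrite ?inE; try by move/eqP ->.
by rewrite mem_cat => /orP[/mapP[J /IH <- ->]|/IH].
Qed.

(** * Explicit coefficients of the expansion *)

Section Explicit.
Variables (u v : word) (h : nat -> rat).

(** The coefficient of z in the exponent at t = 0. The weight of [v] is counted from its first
    possible index; the gaps after it are summed in [tailsum]. *)
Definition shiftwt (I : seq nat) m : nat :=
  (\sum_(p <- zip I u) p.1 * p.2.2 + (size (val m)).+1 * wt v)%N.

Definition expcoef n m : {poly rat} :=
  \sum_(I <- incs (iota 1 (size (val m))) (size u))
    (if mkmono (expo I u) == m
     then n`!%:R^-1 *: ((shiftwt I m)%:R%:P + (wt (u ++ v))%:R *: 'X) ^+ n else 0).

Definition regcoef n m : {poly rat} := \sum_(i < n.+1) h i *: expcoef (n - i) m.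

(* z^(size v) times the series has the coefficients [regcoef]. *)
Definition regser : fser := fun m n =>
  if n < - (size v)%:Z then 0 else regcoef `|n + (size v)%:Z| m.

Lemma wt_cat a b : wt (a ++ b) = (wt a + wt b)%N.
Proof. by rewrite /wt map_cat sumn_cat. Qed.

Lemma prod_wexp (I : seq nat) (w : word) t z : size I = size w ->
  \prod_(p <- zip I w) wexp t z p.1 p.2 =
  cexp (((\sum_(p <- zip I w) p.1 * p.2.2)%N%:R + t%:C * (wt w)%:R) * z).
Proof.
elim: I w => [|i I IH] [|l w] //=; first by rewrite !big_nil mulr0 addr0 mul0r cexp0.
move=> [/IH e]; rewrite !big_cons e /wexp -cexpD wt_cons; congr cexp.
by rewrite !natrD natrM /=; ring.
Qed.

Lemma exps_expcoef m t :
  exps (fun n => peval t (expcoef n m))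
    (fun z => phi_partial u m t z (size (val m)) *
      cexp (((size (val m)).+1%:R + t%:C) * (wt v)%:R * z)).
Proof.
pose d I : C := (shiftwt I m)%:R + (wt (u ++ v))%:R * t%:C.
have := @exps_sum R _ (incs (iota 1 (size (val m))) (size u))
  (fun I n => if mkmono (expo I u) == m then d I ^+ n / n`!%:R else 0)
  (fun I z => if mkmono (expo I u) == m then cexp (d I * z) else 0).
move=> H; apply: eq_exps (H _) => [n|z _|I].
- rewrite peval_sum; apply: eq_bigr => I _; case: ifP => _; last by rewrite peval0.
  rewrite pevalZ pevalXn pevalD pevalC pevalZ pevalX !ratr_nat mulrC.
  by rewrite fmorphV rmorph_nat.
- rewrite /phi_partial mulr_suml; apply: eq_big_seq => I /incs_size hI.
  case: ifP => _; last by rewrite mul0r.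
  rewrite (prod_wexp _ _ hI) -cexpD; congr cexp; rewrite /d /shiftwt wt_cat !natrD natrM.
  by ring.
- case: (mkmono _ == m); first exact: exps_cexp.
  by apply: eq_exps (exps_const 0) => [n|//]; case: ifP.
Qed.

Lemma exps_regser m t : Gword u -> all (fun l : letter => l.1 == 0%N) v -> Hword (u ++ v) ->
  exps (fun n => ratr (h n)) (fun z : C => z ^+ size v * tailsum z v) ->
  exps (fun n => peval t (regser m (n%:Z - (size v)%:Z)))
    (fun z => z ^+ size v * phival (u ++ v) m t z).
Proof.
move=> hu hv huv hh; have /andP[_ hhv] : Hword u && Hword v by rewrite -all_cat.
apply: eq_exps (exps_mul hh (exps_expcoef m t)) => [n|z z0].
  have -> : regser m (n%:Z - (size v)%:Z) = regcoef n m.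
    by rewrite /regser ifF; [congr (regcoef _ m)|]; lia.
  by rewrite /regcoef peval_sum; apply: eq_bigr => i _; rewrite pevalZ.
rewrite (ccvg_unique (phivalP m t huv z0) (phi_partial_cvg m t hu hv hhv z0)); ring.
Qed.

End Explicit.

End Regularization.

(** * Coefficients in GSym *)

Lemma inGSym0 : inGSym (fun=> 0).
Proof. by exists [::]; split=> // m; rewrite big_nil. Qed.

Lemma inGSymD f g : inGSym f -> inGSym g -> inGSym (fun m => f m + g m).
Proof.
move=> [L [hL hf]] [K [hK hg]]; exists (L ++ K); split=> [|m].
  by rewrite all_cat hL.
by rewrite big_cat hf hg.
Qed.

Lemma inGSymZ (c : rat) f : inGSym f -> inGSym (fun m => c * f m).
Proof.
move=> [L [hL hf]]; exists [seq (c * x.1, x.2) | x <- L]; split=> [|m].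
  by rewrite all_map.
by rewrite big_map hf mulr_sumr; apply: eq_bigr => x _; rewrite mulrA.
Qed.

Lemma eq_inGSym f g : (forall m, f m = g m) -> inGSym f -> inGSym g.
Proof. by move=> /boolp.funext ->. Qed.

Lemma inGSym_sum (I : Type) (s : seq I) (f : I -> mono -> rat) :
  (forall i, inGSym (f i)) -> inGSym (fun m => \sum_(i <- s) f i m).
Proof.
move=> h; elim: s => [|i s IH].
  by apply: eq_inGSym inGSym0 => m; rewrite big_nil.
by apply: eq_inGSym (inGSymD (h i) IH) => m; rewrite big_cons.
Qed.

Lemma coef_linear_exp (T : comNzRingType) (c k : T) n j :
  ((c%:P + k *: 'X) ^+ n)`_j = if (j <= n)%N then c ^+ (n - j) * k ^+ j * 'C(n, j)%:R else 0.
Proof.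
rewrite exprDn coef_sum.
have e (i : 'I_n.+1) : (c%:P ^+ (n - i) * (k *: 'X) ^+ i *+ 'C(n, i))`_j =
    if (j == i :> nat) then c ^+ (n - i) * k ^+ i * 'C(n, i)%:R else 0.
  rewrite exprZn -rmorphXn coefMn coefCM coefZ coefXn.
  by case: eqP => _; rewrite ?mulr1 ?mulr_natr // !mulr0 mul0rn.
rewrite (eq_bigr _ (fun i _ => e i)) -big_mkcond /=.
case: leqP => hj.
  by rewrite (big_pred1 (Ordinal (hj : (j < n.+1)%N))) // => i; rewrite eq_sym.
by rewrite big1 // => i /eqP e'; have := ltn_ord i; lia.
Qed.

Fixpoint bump (s : nat) (x : word) : word :=
  match x, s with
  | [::], _ => [::]
  | l :: x', 0%N => (l.1, l.2.+1) :: x'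
  | l :: x', s'.+1 => l :: bump s' x'
  end.

Lemma bump_fst s x : map fst (bump s x) = map fst x.
Proof. by elim: x s => [|l x IH] [|s] //=; rewrite IH. Qed.

Lemma size_bump s x : size (bump s x) = size x.
Proof. by rewrite -(size_map fst) bump_fst size_map. Qed.

Lemma Gword_bump s x : Gword (bump s x) = Gword x.
Proof.
rewrite /Gword -!size_eq0 size_bump.
by rewrite -!(last_map fst) bump_fst.
Qed.

Lemma expo_bump I s x : expo I (bump s x) = expo I x.
Proof.
by rewrite /expo; congr foldr; elim: x s I => [|l x IH] [|s] [|i I] //=; rewrite IH.
Qed.

Lemma prod_bump I s x : size I = size x -> (s < size x)%N ->
  (\prod_(p <- zip I (bump s x)) p.1 ^ p.2.2 = nth 0 I s * \prod_(p <- zip I x) p.1 ^ p.2.2)%N.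
Proof.
elim: x s I => [|l x IH] [|s] [|i I] //= [hI] hs; rewrite !big_cons /=.
  by rewrite expnS mulnA.
by rewrite IH // mulnCA.
Qed.

Lemma incs_subseq s k I : I \in incs s k -> subseq I s.
Proof.
elim: s k I => [|x s IH] [|k] I //=; rewrite ?inE; try by move/eqP ->.
rewrite mem_cat => /orP[/mapP[J /IH h ->]|/IH h]; first by rewrite /= eqxx.
exact: subseq_trans h (subseq_cons _ _).
Qed.

Lemma path_ltn_last i I x : path ltn i I -> x \in i :: I -> (x <= last i I)%N.
Proof.
elim: I i x => [|j I IH] i x /=; first by rewrite inE => _ /eqP ->.
move=> /andP[ij hp]; rewrite inE => /orP[/eqP ->|/(IH _ _ hp) //].
exact: leq_trans (ltnW ij) (IH _ _ hp (mem_head _ _)).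
Qed.

Lemma size_addl s t : size (addl s t) = maxn (size s) (size t).
Proof. by elim: s t => [|a s IH] [|b t] //=; rewrite ?maxn0 // IH maxnSS. Qed.

Lemma size_mnorm s : (size (mnorm s) <= size s)%N.
Proof. by elim: s => [|a s IH] //=; case: ifP. Qed.

Lemma size_expo I x n : all (fun i => 0 < i <= n)%N I -> (size (expo I x) <= n)%N.
Proof.
elim: I x => [|i I IH] [|l x] //= /andP[/andP[i0 hi] hI].
rewrite -/(expo I x) size_addl geq_max IH // andbT.
by rewrite /unitexp size_rcons size_nseq prednK.
Qed.

(** The product has no variable beyond its last index, so the size of [m] is at most that index; the
    converse holds since all indices come from [1, size m]. For the empty tuple the default 0 agrees
    with the size of the monomial 1. *)
Lemma last_match (m : mono) I x : I \in incs (iota 1 (size (val m))) (size x) ->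
  mkmono (expo I x) == m -> last 0%N I = size (val m).
Proof.
move=> hI /eqP hm; have hs := incs_subseq hI.
have hmem i : i \in I -> (0 < i <= size (val m))%N.
  by move=> /(mem_subseq hs); rewrite mem_iota add1n ltnS.
have srt : sorted ltn I by apply: subseq_sorted hs (iota_ltn_sorted _ _); exact: ltn_trans.
have hsz : (size (val m) <= last 0 I)%N.
  rewrite -hm; apply: leq_trans (size_mnorm _) (size_expo _ _).
  apply/allP => i hi; have /andP[-> _] := hmem i hi; case: I srt hi {hI hm hs hmem} => // j I.
  exact: path_ltn_last.
apply/eqP; rewrite eqn_leq hsz andbT; case: (lastP I) hmem => // J i h.
by rewrite last_rcons; have := h i; rewrite mem_rcons mem_head => /(_ isT) /andP[].
Qed.

Section Weights.
Variable k : nat.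

Definition wMhat (x : word) (f : seq nat -> rat) (m : mono) : rat :=
  \sum_(I <- incs (iota 1 (size (val m))) (size x))
     (if mkmono (expo I x) == m
      then f I * (\prod_(p <- zip I x) p.1 ^ p.2.2)%N%:R else 0).

(* Polynomials in the indices i_1 < ... < i_k act on the Stirling functions of
   length [k]; [gweight f] says that [f] maps them into GSym. *)
Definition gweight (f : seq nat -> rat) : Prop :=
  forall x, Gword x -> size x = k -> inGSym (wMhat x f).

Lemma eq_gweight f g : (forall I, size I = k -> f I = g I) -> gweight f -> gweight g.
Proof.
move=> h hf x hx hk; apply: eq_inGSym (hf x hx hk) => m.
by apply: eq_big_seq => I /incs_size hI; rewrite h // hI.
Qed.

Lemma gweight1 : gweight (fun=> 1).
Proof.
move=> x hx _; exists [:: (1, x)]; split=> [|m]; first by rewrite /= hx.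
rewrite big_seq1 mul1r; apply: eq_bigr => I _; case: ifP => // _.
by rewrite mul1r natr_prod.
Qed.

Lemma gweightZ c f : gweight f -> gweight (fun I => c * f I).
Proof.
move=> hf x hx hk; apply: eq_inGSym (inGSymZ c (hf x hx hk)) => m.
by rewrite mulr_sumr; apply: eq_bigr => I _; case: ifP; rewrite ?mulr0 ?mulrA.
Qed.

Lemma gweightD f g : gweight f -> gweight g -> gweight (fun I => f I + g I).
Proof.
move=> hf hg x hx hk; apply: eq_inGSym (inGSymD (hf x hx hk) (hg x hx hk)) => m.
by rewrite -big_split; apply: eq_bigr => I _ /=; case: ifP; rewrite ?addr0 ?mulrDl.
Qed.

Lemma gweight_sum (J : Type) (s : seq J) (f : J -> seq nat -> rat) :
  (forall j, gweight (f j)) -> gweight (fun I => \sum_(j <- s) f j I).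
Proof.
move=> h; elim: s => [|j s IH].
  by apply: eq_gweight (gweightZ 0 gweight1) => I _; rewrite big_nil mul0r.
by apply: eq_gweight (gweightD (h j) IH) => I _; rewrite big_cons.
Qed.

Lemma gweight_nth s f : (s < k)%N -> gweight f -> gweight (fun I => (nth 0%N I s)%:R * f I).
Proof.
move=> hs hf x hx hk; apply: eq_inGSym (hf (bump s x) _ _) => [m||]; last 2 first.
- by rewrite Gword_bump.
- by rewrite size_bump.
rewrite /wMhat size_bump; apply: eq_big_seq => I /incs_size hI; rewrite expo_bump.
case: ifP => // _; rewrite prod_bump ?hI ?hk // natrM; ring.
Qed.

Lemma gweight_last f : gweight f -> gweight (fun I => (last 0%N I)%:R * f I).
Proof.
move=> hf; have [k0|k0] := posnP k.
  apply: eq_gweight (gweightZ 0 hf) => I; rewrite k0 => /size0nil ->.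
  by rewrite mul0r.
apply: eq_gweight (gweight_nth (_ : k.-1 < k)%N hf) => [I hI|]; last by rewrite prednK.
by rewrite -(nth_last 0%N I) hI.
Qed.

(** The last index has its own coefficient [c] and there is a constant [d] because the tail starts
    at the last index plus one. One factor of the power is expanded at a time. *)
Lemma gweight_exp (b : 'I_k -> rat) (c d : rat) e :
  gweight (fun I => (\sum_(s < k) (nth 0%N I s)%:R * b s + (last 0%N I)%:R * c + d) ^+ e).
Proof.
elim: e => [|e IH]; first exact: gweight1.
have h1 := gweight_sum (index_enum 'I_k) (fun s : 'I_k => gweightZ (b s) (gweight_nth (ltn_ord s) IH)).
apply: eq_gweight (gweightD (gweightD h1 (gweightZ c (gweight_last IH))) (gweightZ d IH)) => I _.
rewrite exprS !mulrDl; congr (_ + _ + _); last by ring.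
by rewrite mulr_suml; apply: eq_bigr => s _; ring.
Qed.

End Weights.

(** The size of the monomial is traded for the last index. The weight becomes a linear form with
    coefficients independent of [m], as a fixed combination of Stirling functions requires. *)
Lemma shiftwt_linear u v m I : size I = size u ->
  mkmono (expo I u) == m -> I \in incs (iota 1 (size (val m))) (size u) ->
  (shiftwt u v I m)%:R =
  \sum_(s < size u) (nth 0%N I s)%:R * (nth (0, 0)%N u s).2%:R + (last 0%N I)%:R * (wt v)%:R + (wt v)%:R :> rat.
Proof.
move=> hI hm hin; rewrite /shiftwt (last_match hin hm) natrD natrM -natr1 mulrDl mul1r addrA; congr (_ + _ + _).
rewrite (big_nth (0, (0, 0))%N) size_zip hI minnn big_mkord natr_sum.
by apply: eq_bigr => s _; rewrite nth_zip //= natrM.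
Qed.

Lemma inGSym_expcoef u v n j : Gword u -> inGSym (fun m => (expcoef u v n m)`_j).
Proof.
move=> hu; pose S e m : rat := \sum_(I <- incs (iota 1 (size (val m))) (size u))
  (if mkmono (expo I u) == m then (shiftwt u v I m)%:R ^+ e else 0).
have hS e : inGSym (S e).
  (* With all beta_s = 0 the Stirling summand is 1, and the powers of the indices come from the
     weight alone. *)
  pose x := [seq (l.1, 0%N) | l : letter <- u].
  have hx : size x = size u by rewrite size_map.
  have gx : Gword x.
    by move: hu; rewrite /Gword -!size_eq0 hx -!(last_map fst) -map_comp.
  have ex I : expo I x = expo I u.
    by rewrite /expo; congr foldr; rewrite {hx gx hu S} /x; elim: u I => [|l u IH] [|i I] //=; rewrite IH.
  have := @gweight_exp (size u) (fun s => (nth (0, 0)%N u s).2%:R) (wt v)%:R (wt v)%:R e x gx hx.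
  apply: eq_inGSym => m; rewrite /wMhat hx; apply: eq_big_seq => I hI.
  rewrite ex; case: ifP => // hm; rewrite (shiftwt_linear _ (incs_size hI) hm hI).
  suff -> : (\prod_(p <- zip I x) p.1 ^ p.2.2 = 1)%N by rewrite mulr1.
  rewrite big1_seq // => p /andP[_ /(map_f snd)].
  rewrite -/(unzip2 _) unzip2_zip; last by rewrite hx (incs_size hI).
  by move=> /mapP[l _ ->].
(* The binomial theorem gives the coefficient of t^j in (shift + weight t)^n / n! as this constant
   times shift^(n-j). *)
pose c : rat := if (j <= n)%N then n`!%:R^-1 * ((wt (u ++ v))%:R ^+ j * 'C(n, j)%:R) else 0.
apply: eq_inGSym (inGSymZ c (hS (n - j)%N)) => m.
rewrite coef_sum /S mulr_sumr; apply: eq_bigr => I _; case: ifP => _; last by rewrite coef0 mulr0.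
rewrite coefZ coef_linear_exp /c; case: ifP => _; last by rewrite mul0r mulr0.
by ring.
Qed.

Lemma size_expcoef u v n m : (size (expcoef u v n m) <= n.+1)%N.
Proof.
apply/leq_sizeP => j hj; rewrite coef_sum big1 // => I _; case: ifP => _; last by rewrite coef0.
by rewrite coefZ coef_linear_exp leqNgt hj mulr0.
Qed.

Lemma regser_in_GSym u v h : Gword u -> in_GSym_t_Laurent (regser u v h).
Proof.
move=> hu; split; first by exists (size v) => m n; rewrite /regser => ->.
move=> n; rewrite /regser; case: (n < - (size v)%:Z).
  split; first by exists 0%N => m; rewrite size_poly0.
  by move=> j; apply: eq_inGSym inGSym0 => m; rewrite coef0.
set N := absz _; split=> [|j].
  exists N.+1 => m; apply: leq_trans (size_sum _ _ _) _; apply/bigmax_leqP => i _.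
  apply: leq_trans (size_scale_leq _ _) _; apply: leq_trans (size_expcoef _ _ _ _) _.
  by rewrite ltnS leq_subr.
have := inGSym_sum (index_enum 'I_N.+1) (fun i : 'I_N.+1 => inGSymZ (h i) (inGSym_expcoef v (N - i) j hu)).
apply: eq_inGSym => m; rewrite coef_sum; apply: eq_bigr => i _; by rewrite coefZ.
Qed.

(** * The quasi-shuffle homomorphism *)

Section Homomorphism.
Variable R : realType.
Local Notation C := R[i].
Implicit Types (F G : fser) (z : C) (t : R) (a b v w : word) (m : mono).

(** One pole bound serves all monomials: the product at [m] mixes coefficients at all divisors of
    [m], which must be shifted alike. *)
Definition uniform_regularization w F (N : nat) : Prop := forall m,
  (forall n, n < - N%:Z -> F m n = 0) /\
  forall t, exps (fun i => peval t (F m (i%:Z - N%:Z))) (fun z => z ^+ N * phival w m t z).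

Lemma uniform_is_regularization w F N : Hword w -> uniform_regularization w F N ->
  is_regularization R w F.
Proof.
by move=> hw h; apply/(@is_regularizationP R w F hw) => m; exists N; have [h1 h2] := h m.
Qed.

Lemma uniform_regularization_leq w F N K : (N <= K)%N ->
  uniform_regularization w F N -> uniform_regularization w F K.
Proof.
move=> NK h m; have [h1 h2] := h m; split=> [n hn|t]; first by apply: h1; lia.
exact: (exps_lower h1 NK (h2 t)).
Qed.

Lemma regser_exists u v : Gword u -> all (fun l : letter => l.1 == 0%N) v -> Hword (u ++ v) ->
  exists h, uniform_regularization (u ++ v) (regser u v h) (size v).
Proof.
move=> hu hv huv; have /andP[_ hhv] : Hword u && Hword v by rewrite -all_cat.
have [h hh] := exps_tailsum R hhv; exists h => m; split=> [n|t]; first by rewrite /regser => ->.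
exact: exps_regser.
Qed.

Lemma regularization_exists w : Hword w -> exists F, is_regularization R w F.
Proof.
have [u [v [-> hu hv]]] := word_split w => huv.
have [h hh] := regser_exists hu hv huv.
by exists (regser u v h); apply: uniform_is_regularization hh.
Qed.

Lemma regularization_regser u v F : Gword u -> all (fun l : letter => l.1 == 0%N) v -> Hword (u ++ v) ->
  is_regularization R (u ++ v) F -> exists h, F = regser u v h.
Proof.
move=> hu hv huv hF; have [h hh] := regser_exists hu hv huv; exists h.
exact: regularization_unique hF (uniform_is_regularization huv hh).
Qed.

Lemma regularization_uniform w F : Hword w -> is_regularization R w F ->
  exists N, uniform_regularization w F N.
Proof.
have [u [v [-> hu hv]]] := word_split w => huv hF.
have [h hh] := regser_exists hu hv huv; exists (size v).
by rewrite (regularization_unique huv hF (uniform_is_regularization huv hh)).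
Qed.

Lemma eventually_all (T : eqType) (s : seq T) (P : T -> nat -> Prop) :
  (forall x, x \in s -> exists N, forall K, (N <= K)%N -> P x K) ->
  exists N, forall K, (N <= K)%N -> forall x, x \in s -> P x K.
Proof.
elim: s => [|x s IH] h; first by exists 0%N.
have [N hN] := h x (mem_head _ _).
have [M hM] := IH (fun y hy => h y (mem_behead (s := x :: s) hy)).
exists (maxn N M) => K; rewrite geq_max => /andP[NK MK] y.
by rewrite inE => /orP[/eqP ->|/(hM _ MK)]; [apply: hN|].
Qed.

Lemma Hword_qsh a b : Hword a -> Hword b -> all Hword (qsh a b).
Proof.
elim: a b => [|x a IHa] b; first by move=> _ hb; rewrite /= hb.
elim: b => [|y b IHb] ha hb; first by rewrite /= andbT.
have -> : qsh (x :: a) (y :: b) = map (cons x) (qsh a (y :: b)) ++ map (cons y) (qsh (x :: a) b)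
                   ++ map (cons (x.1 + y.1, x.2 + y.2)%N) (qsh a b) by [].
have /andP[x0 ha'] := ha; have /andP[y0 hb'] := hb.
rewrite !all_cat !all_map; apply/and3P; split.
- by apply: sub_all (IHa _ ha' hb) => w hw; rewrite /= x0.
- by apply: sub_all (IHb ha hb') => w hw; rewrite /= y0.
- by apply: sub_all (IHa _ ha' hb') => w hw; rewrite /= addn_gt0 x0.
Qed.

Lemma phival_mul a b m t z : Hword a -> Hword b -> complex.Re z < 0 ->
  \sum_(s <- below (val m)) phival a (mkmono s) t z * phival b (mkmono (subl (val m) s)) t z =
  \sum_(w <- qsh a b) phival w m t z.
Proof.
move=> ha hb z0.
have h1 := @ccvg_sum R _ (below (val m)) xpredT _ _
  (fun s => ccvgM (phivalP (mkmono s) t ha z0) (phivalP (mkmono (subl (val m) s)) t hb z0)).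
rewrite [RHS]big_seq_cond; apply: ccvg_unique h1 _.
(* [ccvg_sum] wants a limit for every word, while [phivalP] gives one only for words in [Hword],
   such as those of the quasi-shuffle; hence the guard. *)
have h2 w : ccvg (fun L => if w \in qsh a b then phi_partial w m t z L else 0)
    (if w \in qsh a b then phival w m t z else 0).
  by case: ifP => [/(allP (Hword_qsh ha hb)) hw|_]; [exact: phivalP|exact: ccvg_cst].
have := ccvg_sum (qsh a b) xpredT h2; rewrite -big_mkcond /=.
under [in X in _ -> ccvg _ X]eq_bigl do rewrite andbT.
apply: eq_ccvg => L; rewrite -big_mkcond -big_seq.
have hE i (x y : letter) : wexp t z i (x.1 + y.1, x.2 + y.2)%N = wexp t z i x * wexp t z i y.
  by rewrite /wexp -cexpD natrD /=; congr cexp; ring.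
rewrite (eq_bigr (fun w => wsum (wexp t z) L 1 w (val m))); last by move=> w _; rewrite phi_partialE.
rewrite -(wsum_mul _ _ _ _ _ hE); apply: eq_bigr => s _.
by rewrite !phi_partialE /= !wsum_mnorm.
Qed.

Lemma sum_ord_trunc (V : nmodType) (X : nat -> V) p q :
  (forall i, (p <= i)%N -> X i = 0) -> (p <= q)%N -> \sum_(i < q) X i = \sum_(i < p) X i.
Proof.
move=> h pq; rewrite -(subnKC pq) big_split_ord /= [X in _ + X]big1 ?addr0 //.
by move=> i _; rewrite h // leq_addr.
Qed.

Section Morphism.
Variable Phi : word -> fser.
Hypothesis PhiP : forall w, Hword w -> is_regularization R w (Phi w).

(* Shifting all Laurent series by the truncation bound K makes [fmul_trunc] a
   Cauchy product up to terms that vanish. *)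
Lemma word_fprod a b m n : Hword a -> Hword b -> exists K0, forall K, (K0 <= K)%N ->
  \sum_(w <- qsh a b) Phi w m n = fmul_trunc (Phi a) (Phi b) K m n.
Proof.
move=> ha hb.
have [N hN] : exists N, forall K, (N <= K)%N -> forall w, w \in a :: b :: qsh a b ->
    uniform_regularization w (Phi w) K.
  apply: eventually_all => w hw.
  have {}hw : Hword w.
    by move: hw; rewrite !inE => /or3P[/eqP ->|/eqP ->|/(allP (Hword_qsh ha hb))].
  have [N hN] := regularization_uniform hw (PhiP hw); exists N => K NK.
  exact: uniform_regularization_leq hN.
exists (N + absz n)%N => K hK; apply: peval_inj => t t0.
have NK : (N <= K)%N by lia.
have NKK : (N <= K + K)%N by lia.
have hAN m' k : k < - N%:Z -> Phi a m' k = 0.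
  by have [h _] := hN N (leqnn N) a (mem_head _ _) m'; exact: h.
have hb_in : b \in a :: b :: qsh a b by rewrite !inE eqxx orbT.
have hBN m' k : k < - N%:Z -> Phi b m' k = 0.
  by have [h _] := hN N (leqnn N) b hb_in m'; exact: h.
have hA m' := (hN K NK a (mem_head _ _) m').2 t.
have hB m' := (hN K NK b hb_in m').2 t.
have hprod := exps_sum (below (val m))
  (fun s => exps_mul (hA (mkmono s)) (hB (mkmono (subl (val m) s)))).
have hsum := exps_sum (qsh a b) (fun w =>
  (_ : exps (fun i => if w \in qsh a b then peval t (Phi w m (i%:Z - (K + K)%N%:Z)) else 0)
    (fun z => if w \in qsh a b then z ^+ (K + K) * phival w m t z else 0))).
have {}hsum : exps (fun i => \sum_(w <- qsh a b) peval t (Phi w m (i%:Z - (K + K)%N%:Z)))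
    (fun z => \sum_(s <- below (val m)) (z ^+ K * phival a (mkmono s) t z) *
      (z ^+ K * phival b (mkmono (subl (val m) s)) t z)).
  apply: eq_exps (hsum _) => [i|z z0|w].
  - by rewrite -big_mkcond -big_seq.
  - rewrite -big_mkcond -big_seq -mulr_sumr -phival_mul // mulr_sumr.
    by apply: eq_bigr => s _; rewrite exprD; ring.
  - case hw: (w \in qsh a b).
      have hw' : w \in a :: b :: qsh a b by rewrite !inE hw !orbT.
      exact: (hN _ NKK w hw' m).2 t.
    by apply: eq_exps (exps_const 0) => [i|//]; case: ifP.
(* The place of z^n after both factors are shifted by K; n + 2K is nonnegative since K >= |n|. *)
pose P := absz (n + (K + K)%N%:Z).
have hP : P%:Z = n + (K + K)%N%:Z by rewrite /P; lia.
have := exps_unique hsum hprod P.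
have -> : P%:Z - (K + K)%N%:Z = n by lia.
rewrite -peval_sum => ->; rewrite /fmul_trunc peval_sum; apply: eq_bigr => s _.
rewrite peval_sum.
pose X i : C := peval t (Phi a (mkmono s) (i%:Z - K%:Z)) *
  peval t (Phi b (mkmono (subl (val m) s)) (n - (i%:Z - K%:Z))).
transitivity (\sum_(i < P.+1) X i).
  apply: eq_bigr => i _; rewrite /X; congr (_ * peval t (Phi b _ _)).
  by have := ltn_ord i; lia.
transitivity (\sum_(i < K.*2.+1) X i); last by apply: eq_bigr => i _; rewrite pevalM.
(* The Cauchy product stops at P = n + 2K and the truncation at 2K. Past either bound the exponent n
   - (i - K) of the second factor is below -N, because K >= N + |n|, so both sums equal the longer
   one. *)
have e1 : \sum_(i < P.+1 + K.*2.+1) X i = \sum_(i < P.+1) X i.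
  by apply: sum_ord_trunc (leq_addr _ _) => i hi; rewrite /X hBN ?peval0 ?mulr0 //; lia.
have e2 : \sum_(i < P.+1 + K.*2.+1) X i = \sum_(i < K.*2.+1) X i.
  by apply: sum_ord_trunc (leq_addl _ _) => i hi; rewrite /X hBN ?peval0 ?mulr0 //; lia.
by rewrite -e1 e2.
Qed.

Lemma fmul_trunc_suml (T : Type) (s : seq T) (c : T -> rat) (F : T -> fser) G K m n :
  fmul_trunc (fun m n => \sum_(x <- s) c x *: F x m n) G K m n =
  \sum_(x <- s) c x *: fmul_trunc (F x) G K m n.
Proof.
rewrite /fmul_trunc; under [RHS]eq_bigr do rewrite scaler_sumr.
rewrite [RHS]exchange_big /=; apply: eq_bigr => r _.
under [RHS]eq_bigr do rewrite scaler_sumr.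
rewrite [RHS]exchange_big /=; apply: eq_bigr => i _.
by rewrite mulr_suml; apply: eq_bigr => x _; rewrite scalerAl.
Qed.

Lemma fmul_trunc_sumr (T : Type) (s : seq T) (c : T -> rat) F (G : T -> fser) K m n :
  fmul_trunc F (fun m n => \sum_(x <- s) c x *: G x m n) K m n =
  \sum_(x <- s) c x *: fmul_trunc F (G x) K m n.
Proof.
rewrite /fmul_trunc; under [RHS]eq_bigr do rewrite scaler_sumr.
rewrite [RHS]exchange_big /=; apply: eq_bigr => r _.
under [RHS]eq_bigr do rewrite scaler_sumr.
rewrite [RHS]exchange_big /=; apply: eq_bigr => i _.
by rewrite mulr_sumr; apply: eq_bigr => x _; rewrite scalerAr.
Qed.

Lemma hlin_fprod (u v : hcomb) :
  all (fun x => Hword x.2) u -> all (fun x => Hword x.2) v ->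
  is_fprod (hlin Phi u) (hlin Phi v) (hlin Phi (qmul u v)).
Proof.
move=> hu hv m n.
have h p : p \in [seq (x, y) | x <- u, y <- v] -> exists N, forall K, (N <= K)%N ->
    \sum_(w <- qsh p.1.2 p.2.2) Phi w m n = fmul_trunc (Phi p.1.2) (Phi p.2.2) K m n.
  case: p => x y /allpairsP[p [hx hy [-> ->]]].
  by apply: word_fprod; [apply: (allP hu)|apply: (allP hv)].
have [N hN] := eventually_all h.
exists N => K /hN hK; rewrite fmul_trunc_suml /hlin /qmul big_flatten big_allpairs_dep /=.
apply: eq_big_seq => x hx; rewrite fmul_trunc_sumr scaler_sumr.
apply: eq_big_seq => y hy; rewrite big_map /= -scaler_sumr scalerA.
congr (_ *: _); apply: (hK (x, y)); exact: allpairs_f.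
Qed.

(** The empty word has only the empty tuple, so its sum is the constant 1; [fone] is therefore a
    regularization of it, and uniqueness applies. *)
Lemma hlin_one : hlin Phi [:: (1, [::])] = fone.
Proof.
have h0 : Hword [::] by [].
have -> : hlin Phi [:: (1, [::])] = Phi [::].
  by apply/boolp.funext => m; apply/boolp.funext => n; rewrite /hlin big_seq1 scale1r.
apply: (regularization_unique h0 (PhiP h0)).
apply: (@uniform_is_regularization _ _ 0) => // m; split=> [n|t].
  by rewrite /fone; case: eqP => //= _; case: eqP => // ->.
apply: eq_exps (exps_const (val m == [::])%:R) => [i|z z0].
  rewrite /fone subr0; case: (val m == [::]) => /=; last by rewrite peval0; case: ifP.
  case: i => [|i] /=; rewrite ?peval0 //.
  by rewrite -polyC1 pevalC; exact: (esym (ratr_nat C 1)).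
rewrite mul1r; apply: ccvg_unique (phivalP m t h0 z0).
apply: eq_ccvg (ccvg_cst _) => L; rewrite phi_partialE wsum_nil canon_all0 ?(valP m) //.
by rewrite /nilp size_eq0.
Qed.

End Morphism.

End Homomorphism.

Theorem theorem3p2 (R : realType) :
  (forall w : word, Hword w ->
     (exists F : fser, is_regularization R w F) /\
     (forall F G : fser, is_regularization R w F -> is_regularization R w G -> F = G) /\
     (forall F : fser, is_regularization R w F -> in_GSym_t_Laurent F)) /\
  (forall Phi : word -> fser,
     (forall w : word, Hword w -> is_regularization R w (Phi w)) ->
     hlin Phi [:: (1, [::])] = fone /\
     forall u v : hcomb, all (fun x => Hword x.2) u -> all (fun x => Hword x.2) v ->
       is_fprod (hlin Phi u) (hlin Phi v) (hlin Phi (qmul u v))) /\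
  (forall (w : word) (F : fser), Hword w -> w != [::] -> (0 < (last (0%N, 0%N) w).1)%N ->
     is_regularization R w F -> in_GSym_t_pow F).
Proof.
split=> [w hw|].
  split; first exact: regularization_exists.
  split=> [F G|F]; first exact: regularization_unique.
  move: hw; have [u [v [-> hu hv]]] := word_split w => huv hF.
  have [h ->] := regularization_regser hu hv huv hF.
  exact: regser_in_GSym.
split=> [Phi hPhi|w F hw _ hl hF].
  by split; [exact: (hlin_one hPhi)|exact: (hlin_fprod hPhi)].
have gw : Gword w by rewrite /Gword hl orbT.
(* Since alpha_k > 0 the divergent suffix is empty, so the pole bound of [regser] is 0. *)
rewrite -[w]cats0 in hw hF; have [h ->] := regularization_regser gw (isT : all _ [::]) hw hF.
split; first exact: regser_in_GSym.
by move=> m n hn; rewrite /regser oppr0 hn.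
Qed.
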